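(* Let $\emptyset\neq G\subsetneq \mathbb{R}^n$ be an open set, $0<s<1$ and $1<p<\infty$. Then there is a constant $C=C(n,p,s)>0$, depending only on $n$, $p$ and $s$, such that the inequality $$\int_G \int_G \frac{\lvert M_G f(x)-M_G f(y)\rvert^p}{\lvert x-y\rvert^{n+sp}}\,dy\,dx \le C \int_G \int_G \frac{\lvert f(x)-f(y)\rvert^p}{\lvert x-y\rvert^{n+sp}}\,dy\,dx$$ holds for every $f\in L^p(G)$. In particular, the local Hardy--Littlewood maximal operator $M_G$ is bounded on the fractional Sobolev space $W^{s,p}(G)$, i.e. $M_G$ maps $W^{s,p}(G)$ into itself and there is a constant $C'>0$ with $\lVert M_G f\rVert_{W^{s,p}(G)}\le C'\lVert f\rVert_{W^{s,p}(G)}$ for every $f\in W^{s,p}(G)$.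
   Context: For an open set $\emptyset\neq G\subsetneq\mathbb{R}^n$ and $f\in L^1_{\mathrm{loc}}(G)$, the local Hardy--Littlewood maximal function is $$M_G f(x)=\sup_{0<r<\operatorname{dist}(x,\partial G)} \frac{1}{\lvert B(x,r)\rvert}\int_{B(x,r)}\lvert f(y)\rvert\,dy,\qquad x\in G,$$ where $B(x,r)$ is the open ball with center $x$ and radius $r$, and $\lvert\cdot\rvert$ denotes Lebesgue measure for sets. For $0<s<1$, $1<p<\infty$ and a measurable function $f$ on $G$ that is finite almost everywhere, write $$\lvert f\rvert_{W^{s,p}(G)}=\bigg(\int_G\int_G\frac{\lvert f(x)-f(y)\rvert^p}{\lvert x-y\rvert^{n+sp}}\,dy\,dx\bigg)^{1/p}.$$ The fractional Sobolev space $W^{s,p}(G)$ consists of all $f\in L^p(G)$ with $\lVert f\rVert_{W^{s,p}(G)}=\lVert f\rVert_{L^p(G)}+\lvert f\rvert_{W^{s,p}(G)}<\infty$. *)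

(* Defs.v *)
From HB Require Import structures.
From mathcomp Require Import all_boot all_order all_algebra.
From mathcomp Require Import all_classical all_reals all_analysis.
From mathcomp Require Import measurable_realfun.

Set Implicit Arguments.
Unset Strict Implicit.
Unset Printing Implicit Defensive.
Import Order.TTheory GRing.Theory Num.Theory.
Import numFieldNormedType.Exports.

Local Open Scope classical_set_scope.
Local Open Scope ring_scope.

(* Row vectors carry the product sigma-algebra, generated by the coordinates,
   exactly as the library does for n.-tuple T. *)
Definition measure_rV_display : measure_display -> measure_display.
Proof. exact. Qed.

Section measurable_rV.
Context {d : measure_display} {T : measurableType d} (n : nat).

Let coors : 'I_n -> 'rV[T]_n -> T := fun i x => x ord0 i.

Let rV_set0 : g_sigma_preimage coors set0.
Proof. exact: sigma_algebra0. Qed.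

Let rV_setC A : g_sigma_preimage coors A -> g_sigma_preimage coors (~` A).
Proof. exact: sigma_algebraC. Qed.

Let rV_bigcup (F : (set 'rV[T]_n)^nat) :
  (forall i, g_sigma_preimage coors (F i)) ->
  g_sigma_preimage coors (\bigcup_i (F i)).
Proof. exact: sigma_algebra_bigcup. Qed.

HB.instance Definition _ := @isMeasurable.Build (measure_rV_display d)
  'rV[T]_n (g_sigma_preimage coors) rV_set0 rV_setC rV_bigcup.

End measurable_rV.

Definition cons_rV (T : Type) (n : nat) (xv : T * 'rV[T]_n) : 'rV[T]_n.+1 :=
  row_mx (const_mx xv.1 : 'rV[T]_1) xv.2.

Definition uncons_rV (T : Type) (n : nat) (v : 'rV[T]_n.+1) : T * 'rV[T]_n :=
  (v ord0 ord0, \row_j v ord0 (lift ord0 j)).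

Lemma uncons_rVK (T : Type) (n : nat) : cancel (@uncons_rV T n) (@cons_rV T n).
Proof.
move=> v; apply/rowP => i; rewrite /cons_rV !mxE.
case: splitP => j ij; rewrite mxE /=; congr (v _ _); apply/val_inj => /=.
  by rewrite ij [j]ord1.
by rewrite ij /bump.
Qed.

Lemma cons_rVK (T : Type) (n : nat) : cancel (@cons_rV T n) (@uncons_rV T n).
Proof.
move=> [x v]; rewrite /uncons_rV; congr pair.
  by rewrite /cons_rV mxE; case: splitP => // j _; rewrite mxE.
apply/rowP => i; rewrite /cons_rV !mxE; case: splitP => j /= ij.
  by have := ltn_ord j; rewrite -ij.
by congr (v _ _); apply/val_inj; move: ij => /= /eqP; rewrite eqSS => /eqP ->.
Qed.

Section measurable_cons_rV.
Context {d : measure_display} {T : measurableType d}.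

Lemma measurable_coord_rV (n : nat) (i : 'I_n) :
  measurable_fun [set: 'rV[T]_n] (fun v : 'rV[T]_n => v ord0 i).
Proof.
move=> _ Y mY; rewrite setTI; apply: sub_sigma_algebra => /=.
rewrite -bigcup_seq/=; exists i => /=; first by rewrite mem_index_enum.
by exists Y => //; rewrite setTI.
Qed.

Lemma measurable_fun_rV {d' : measure_display} {T' : measurableType d'}
    (n : nat) (f : T' -> 'rV[T]_n) :
  (forall i, measurable_fun [set: T'] (fun t => f t ord0 i)) ->
  measurable_fun [set: T'] f.
Proof.
move=> mf.
have pre : g_sigma_preimage (fun i t => f t ord0 i) `<=` @measurable _ T'.
  apply: smallest_sub; first exact: sigma_algebra_measurable.
  case: n => [|n] in f mf *; first by rewrite big_ord0.
  rewrite -bigcup_mkord_ord; apply: bigcup_sub => i Ii.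
  by move=> A [B mB <-]; exact: mf.
have gE := g_sigma_preimage_comp (fun i (v : 'rV[T]_n) => v ord0 i) f.
by move=> _ A mA; apply: pre; rewrite [X in X _]gE; exists A.
Qed.

Lemma measurable_cons_rV (n : nat) :
  measurable_fun [set: T * 'rV[T]_n] (@cons_rV T n).
Proof.
apply: measurable_fun_rV => i; rewrite /cons_rV.
under eq_fun do rewrite mxE.
case: splitP => j _.
  by under eq_fun do rewrite mxE; exact: measurable_fst.
exact: (measurableT_comp (measurable_coord_rV j) measurable_snd).
Qed.

Lemma measurable_uncons_rV (n : nat) :
  measurable_fun [set: 'rV[T]_n.+1] (@uncons_rV T n).
Proof.
apply: measurable_fun_pair; first exact: measurable_coord_rV.
apply: measurable_fun_rV => i.
by under eq_fun do rewrite mxE; exact: measurable_coord_rV.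
Qed.

End measurable_cons_rV.

Section borel_lebesgue.
Context {R : realType}.
Local Notation Rm := (measurableTypeR R).

Section step.
Variables (n : nat) (mu : {sigma_finite_measure set 'rV[Rm]_n -> \bar R}).

Definition borel_lebesgue_step : set 'rV[Rm]_n.+1 -> \bar R :=
  pushforward (lebesgue_measure \x mu)%E (@cons_rV Rm n).

HB.instance Definition _ := Measure.copy borel_lebesgue_step
  (measure_function_pushforward__canonical__measure_function_Measure
    _ (@measurable_cons_rV _ Rm n)).

Let step_sigma_finite : sigma_finite [set: 'rV[Rm]_n.+1] borel_lebesgue_step.
Proof.
have [F [FT ndF Foo]] :=
  (sigma_finiteP _ _).1 (sigma_finiteT (@lebesgue_measure R)).
have [H [HT ndH Hoo]] := (sigma_finiteP _ _).1 (sigma_finiteT mu).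
exists (fun i => @uncons_rV Rm n @^-1` (F i `*` H i)) => [|i].
  rewrite -preimage_bigcup (_ : \bigcup_i _ = setT) ?preimage_setT//.
  rewrite -subTset => -[x v] _.
  have [i _ Fx] : (\bigcup_i F i) x by rewrite -FT.
  have [j _ Hv] : (\bigcup_i H i) v by rewrite -HT.
  exists (maxn i j) => //; split => /=.
    exact: (subsetPset _ _ (ndF _ _ (leq_maxl i j))).
  exact: (subsetPset _ _ (ndH _ _ (leq_maxr i j))).
have [[mF Fi] [mH Hi]] := (Foo i, Hoo i); split.
  rewrite -[X in measurable X]setTI; apply: measurable_uncons_rV => //.
  exact: measurableX.
rewrite /borel_lebesgue_step /pushforward -comp_preimage.
rewrite (_ : _ \o _ = id) ?preimage_id; last first.
  by apply/funext => x /=; rewrite cons_rVK.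
by rewrite product_measure1E// lte_mul_pinfty// ge0_fin_numE.
Qed.

HB.instance Definition _ :=
  Measure_isSigmaFinite.Build _ _ _ borel_lebesgue_step step_sigma_finite.

End step.

(* Lebesgue measure on the Borel sets, by R^(m+1) = R * R^m; R^0 is a point of
   measure 1. *)
Fixpoint borel_lebesgue (n : nat) :
    {sigma_finite_measure set 'rV[Rm]_n -> \bar R} :=
  match n with
  | 0 => \d_(const_mx 0%R : 'rV[Rm]_0)
  | m.+1 => borel_lebesgue_step (borel_lebesgue m)
  end.

(* Lebesgue measure on R^n is the completion of the previous measure. It lives
   on a copy of 'rV[R]_n whose measurable sets are the Lebesgue measurable
   ones, i.e., the Caratheodory measurable sets of the outer measure induced by
   borel_lebesgue n. *)
Definition lebesgue_space (n : nat) : Type :=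
  caratheodory_type (borel_lebesgue n)^*%mu.

HB.instance Definition _ (n : nat) := Measurable.copy (lebesgue_space n)
  (caratheodory_type (borel_lebesgue n)^*%mu).

Definition lebesgue_rV (n : nat) : set (lebesgue_space n) -> \bar R :=
  @completed_measure_extension _ _ _ (borel_lebesgue n).

HB.instance Definition _ (n : nat) :=
  Measure.copy (@lebesgue_rV n)
    (@completed_measure_extension _ _ _ (borel_lebesgue n)).

Let lebesgue_rV_sigma_finite (n : nat) :
  sigma_finite [set: lebesgue_space n] (@lebesgue_rV n).
Proof.
exact/completed_measure_extension_sigma_finite/(sigma_finiteT (borel_lebesgue n)).
Qed.

HB.instance Definition _ (n : nat) := Measure_isSigmaFinite.Build _ _ _
  (@lebesgue_rV n) (@lebesgue_rV_sigma_finite n).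

End borel_lebesgue.
Arguments lebesgue_space R n : clear implicits.
Arguments lebesgue_rV R n : clear implicits.

Section maximal_operator.
Context {R : realType} {n : nat}.
Local Notation Rn := 'rV[R]_n.
Local Notation mu := (lebesgue_rV R n).
Local Notation Ln := (lebesgue_space R n).
Implicit Types (G : set Rn) (f : Rn -> \bar R) (x y : Rn) (r s p : R).

(* The norm of the library on 'rV[R]_n is the sup norm; the Euclidean one is needed. *)
Definition enorm x : R := Num.sqrt (\sum_(i < n) x ord0 i ^+ 2).

Definition eball x r : set Rn := [set y | enorm (x - y) < r].

Definition boundary G : set Rn := closure G `\` interior G.

Definition dist_to x (A : set Rn) : R := inf [set enorm (x - y) | y in A].

Local Open Scope ereal_scope.

(* Functions on G are represented by functions on R^n, whose values outside G
   are never used. *)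
Definition local_maximal G f x : \bar R :=
  ereal_sup [set (mu (eball x r))^-1 * \int[mu]_(y in eball x r) `|f y|
            | r in `]0%R, dist_to x (boundary G)[].

(* On the diagonal the integrand is irrelevant, being evaluated on a null set.
   Likewise oo - oo, which can only occur where f or its maximal function is
   infinite, a null set for f in L^p(G). *)
Definition gagliardo_energy G s p f : \bar R :=
  \int[mu]_(x in G) \int[mu]_(y in G)
    (`|f x - f y| `^ p / (enorm (x - y)%R `^ (n%:R + s * p))%:E).

Definition gagliardo_seminorm G s p f : \bar R :=
  gagliardo_energy G s p f `^ p^-1.

Definition Lp_norm G p f : \bar R := 'N[mu]_p%:E[f \_ G].

Definition in_Lp G p f : Prop :=
  measurable_fun (G : set Ln) (f : Ln -> \bar R) /\
  Lp_norm G p f < +oo.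

Definition sobolev_norm G s p f : \bar R :=
  Lp_norm G p f + gagliardo_seminorm G s p f.

Definition in_sobolev G s p f : Prop :=
  in_Lp G p f /\ sobolev_norm G s p f < +oo.

End maximal_operator.

(* Main.v *)
Require Import Defs.
From mathcomp Require Import all_boot all_order all_algebra.
From mathcomp Require Import all_classical all_reals all_analysis.
From mathcomp Require Import measurable_realfun.
From mathcomp Require Import ring lra.

(** The theorem follows the argument of Luiro and Vahakangas: the increments of
    the local maximal function [M f] are dominated pointwise by maximal functions
    of the increments of [f], on the product space.

    Let [F (a, b) = |f a - f b| / |a - b|^al] on [G * G] with [al = n / p + s], so
    that the energy of [f] is the [p]-th power of the [L^p] norm of [F].  Take [x]
    and [y] in [G] at distance [d], and a ball of radius [r] admissible at [x].
    If [r <= 3 d], the average of [f] over this ball is compared with averages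
    over small balls around [y]: all points involved are at mutual distance at
    most [5 d], so that the error is at most [d^al] times averages of [F] in which
    the two points move independently ([max_fst] and [max_snd]).  If [r > 3 d], it
    is compared with the average over the ball of radius [r - 2 d] around [y],
    which is admissible at [y]; corresponding points of the two balls, under the
    dilation that carries one to the other, are at distance at most [3 d], and
    after an intermediate average over balls of radius [d] the error becomes an
    average of [max_fst F] and [max_snd F] along simultaneous translations of the
    two points ([max_diag]).  This is [ball_max_le]; exchanging [x] and [y] then
    bounds the modulus of the increment.

    The three maximal operators are bounded on [L^p] of the product for [p > 1]:
    by Tonelli this reduces to the maximal theorem on [R^n], in the variable [x]
    for fixed [y], in [y] for fixed [x], or in [x] for fixed [y - x].  The maximal
    theorem itself ([max_fun_strong_type]) concerns averages over cubes; it is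
    derived from the weak-type inequality [max_fun_weak_type], whose proof is a
    Vitali covering argument, by summation over dyadic levels.  It also bounds
    [M f] in [L^p], and with it the second half of the norm.

    Composition with [x + z] does not preserve measurability for the product of
    two Lebesgue sigma-algebras, whence the use of Borel functions above: [|f|]
    agrees almost everywhere on [G] with a finite Borel function
    ([borel_representative], [Lp_represents]), which has the same maximal function
    and at most the same energy. *)

Set Implicit Arguments.
Unset Strict Implicit.
Unset Printing Implicit Defensive.
Import Order.TTheory GRing.Theory Num.Theory.
Import numFieldNormedType.Exports.
Local Open Scope classical_set_scope.
Local Open Scope ring_scope.

(** * Translations and dilations of Lebesgue measure *)

Section affine_change_of_variables.
Context {R : realType}.
Local Notation Rm := (measurableTypeR R).
Local Notation X n := 'rV[Rm]_n.

Lemma measurable_addrV d (T : measurableType d) n (f g : T -> X n) :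
  measurable_fun setT f -> measurable_fun setT g ->
  measurable_fun setT (fun t => (f t + g t : X n)).
Proof.
move=> mf mg; apply: measurable_fun_rV => i.
under eq_fun do rewrite mxE.
apply: (@measurable_funD _ _ R); exact: (measurableT_comp (measurable_coord_rV i)).
Qed.

Lemma measurable_scale_rV d (T : measurableType d) n (c : R) (f : T -> X n) :
  measurable_fun setT f -> measurable_fun setT (fun t => (c *: (f t : 'rV[R]_n) : X n)).
Proof.
move=> mf; apply: measurable_fun_rV => i.
under eq_fun do rewrite mxE.
apply: (@measurable_funM _ _ R) => //.
exact: (measurableT_comp (measurable_coord_rV i)).
Qed.

Lemma measurable_subV d (T : measurableType d) n (f g : T -> X n) :
  measurable_fun setT f -> measurable_fun setT g ->
  measurable_fun setT (fun t => (f t : 'rV[R]_n) - g t : X n).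
Proof.
move=> mf mg.
rewrite (_ : (fun t => _) = (fun t => f t + (-1) *: (g t : 'rV[R]_n) : X n)).
  by apply: measurable_addrV => //; exact: measurable_scale_rV.
by apply/funext => t; rewrite scaleN1r.
Qed.

Lemma cons_rVD n (s t : R) (v w : 'rV[R]_n) :
  cons_rV ((s + t)%R, (v + w)%R) = cons_rV (s, v) + cons_rV (t, w).
Proof.
by apply/rowP => i; rewrite /cons_rV !mxE; case: splitP => j _; rewrite !mxE.
Qed.

Lemma cons_rVZ n (c t : R) (v : 'rV[R]_n) :
  cons_rV ((c * t)%R, (c *: v)%R) = c *: cons_rV (t, v).
Proof.
by apply/rowP => i; rewrite /cons_rV !mxE; case: splitP => j _; rewrite !mxE.
Qed.

Local Open Scope ereal_scope.

Lemma ge0_integral_translate1 (a : R) (h : R -> \bar R) :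
  measurable_fun [set: R] h -> (forall t, 0 <= h t) ->
  \int[lebesgue_measure]_t h (a + t)%R = \int[lebesgue_measure]_t h t.
Proof.
move=> mh h0.
have mT : measurable_fun [set: Rm] (fun t : Rm => (a + t)%R : Rm).
  exact: (@measurable_funD _ _ R).
transitivity (\int[pushforward lebesgue_measure (fun t : Rm => (a + t)%R : Rm)]_t h t).
  by rewrite ge0_integral_pushforward.
apply: eq_measure_integral => A mA _; apply/esym.
pose m : {measure set Rm -> \bar R} := 
  measure_function_pushforward__canonical__measure_function_Measure lebesgue_measure mT.
apply: (lebesgue_measure_unique (mu := m)) => //.
move=> _ [[u v]] /= _ <-.
rewrite /m /= /pushforward (_ : _ @^-1` _ = `](u - a)%R, (v - a)%R]%classic).
  rewrite !lebesgue_measure_itv /= !lte_fin ltrD2r; case: ifP => // _.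
  by congr (_%:E); ring.
by apply/seteqP; split => t /=; rewrite !in_itv /= ltrBlDl lerBrDl.
Qed.

Lemma ge0_integral_scale1 (c : R) (h : R -> \bar R) : (0 < c)%R ->
  measurable_fun [set: R] h -> (forall t, 0 <= h t) ->
  \int[lebesgue_measure]_t h (c * t)%R = c^-1%:E * \int[lebesgue_measure]_t h t.
Proof.
move=> c0 mh h0.
have mT : measurable_fun [set: Rm] (fun t : Rm => (c * t)%R : Rm).
  exact: (@measurable_funM _ _ R).
pose m : {measure set Rm -> \bar R} := 
  measure_function_pushforward__canonical__measure_function_Measure lebesgue_measure mT.
have cv0 : (0 <= c)%R by exact: ltW.
pose k := NngNum cv0.
have -> : \int[lebesgue_measure]_t h t = \int[mscale k m]_t h t.
  apply: eq_measure_integral => A mA _.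
  apply: (lebesgue_measure_unique (mu := mscale k m)) => //.
  move=> _ [[u v]] /= _ <-.
  rewrite /m /mscale /= /pushforward (_ : _ @^-1` _ = `](u / c)%R, (v / c)%R]%classic).
    rewrite !lebesgue_measure_itv /= !lte_fin ltr_pM2r ?invr_gt0//; case: ifP => // _.
      by rewrite -EFinM; congr (_%:E); field; rewrite gt_eqF.
    by rewrite mule0.
  by apply/seteqP; split => t /=; rewrite !in_itv /= ltr_pdivrMr// ler_pdivlMr// ![(t * c)%R]mulrC.
rewrite ge0_integral_mscale//= muleA -EFinM mulVf ?gt_eqF// mul1e.
by rewrite ge0_integral_pushforward.
Qed.

(** Tonelli for the recursive construction of Lebesgue measure. *)
Lemma ge0_integral_cons_rV n (h : 'rV[R]_n.+1 -> \bar R) :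
  measurable_fun [set: X n.+1] h -> (forall x, 0 <= h x) ->
  \int[borel_lebesgue n.+1]_x h x =
  \int[lebesgue_measure]_t \int[borel_lebesgue n]_v h (cons_rV (t, v)).
Proof.
move=> mh h0.
transitivity (\int[pushforward (lebesgue_measure \x borel_lebesgue n) (@cons_rV Rm n)]_x h x); first by [].
rewrite ge0_integral_pushforward//; last exact: measurable_cons_rV.
rewrite preimage_setT (fubini_tonelli1 (h \o @cons_rV Rm n))//=.
by apply: (measurableT_comp mh); exact: measurable_cons_rV.
Qed.

Lemma measurable_fun_cons_rV2 n (h : 'rV[R]_n.+1 -> \bar R) (t : R) :
  measurable_fun [set: X n.+1] h ->
  measurable_fun [set: X n] (fun v => h (cons_rV (t, v))).
Proof.
move=> mh; apply: (measurableT_comp mh).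
apply: (measurableT_comp (@measurable_cons_rV _ Rm n)).
exact: measurable_pair1.
Qed.

Lemma measurable_fun_integral_cons_rV n (h : 'rV[R]_n.+1 -> \bar R) :
  measurable_fun [set: X n.+1] h -> (forall x, 0 <= h x) ->
  measurable_fun [set: Rm] (fun t => \int[borel_lebesgue n]_v h (cons_rV (t, v))).
Proof.
move=> mh h0.
have mhc : measurable_fun setT (h \o @cons_rV Rm n).
  by apply: (measurableT_comp mh); exact: measurable_cons_rV.
exact: (measurable_fun_fubini_tonelli_F _ mhc (fun z => h0 _)).
Qed.

Lemma ge0_integral_translate n (a : 'rV[R]_n) (h : 'rV[R]_n -> \bar R) :
  measurable_fun [set: X n] h -> (forall x, 0 <= h x) ->
  \int[borel_lebesgue n]_x h (a + x)%R = \int[borel_lebesgue n]_x h x.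
Proof.
elim: n a h => [|n IH] a h mh h0.
  by apply: eq_integral => x _; congr h; apply/rowP => -[].
have mha : measurable_fun [set: X n.+1] (fun x => h (a + x)%R).
  by apply: (measurableT_comp mh); exact: measurable_addrV.
rewrite (ge0_integral_cons_rV mha (fun x => h0 _)) (ge0_integral_cons_rV mh h0).
pose a0 := a ord0 ord0; pose a' : 'rV[R]_n := (\row_j a ord0 (lift ord0 j))%R.
pose H (t : R) := \int[borel_lebesgue n]_v h (cons_rV (t, v)).
transitivity (\int[lebesgue_measure]_t H (a0 + t)%R).
  apply: eq_integral => t _; rewrite /H.
  rewrite -[RHS](IH a')//; last exact: measurable_fun_cons_rV2.
  apply: eq_integral => v _; congr h.
  by rewrite -[a in LHS](uncons_rVK a) -cons_rVD.
rewrite ge0_integral_translate1//.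
- exact: measurable_fun_integral_cons_rV.
- by move=> t; exact: integral_ge0.
Qed.

Lemma ge0_integral_scale n (c : R) (h : 'rV[R]_n -> \bar R) : (0 < c)%R ->
  measurable_fun [set: X n] h -> (forall x, 0 <= h x) ->
  \int[borel_lebesgue n]_x h (c *: x)%R = (c ^- n)%:E * \int[borel_lebesgue n]_x h x.
Proof.
move=> c0; elim: n h => [|n IH] h mh h0.
  rewrite expr0 invr1 mul1e.
  by apply: eq_integral => x _; congr h; apply/rowP => -[].
have mha : measurable_fun [set: X n.+1] (fun x => h (c *: (x : 'rV[R]_n.+1))%R).
  by apply: (measurableT_comp mh); exact: measurable_scale_rV.
rewrite (ge0_integral_cons_rV mha (fun x => h0 _)) (ge0_integral_cons_rV mh h0).
pose H (t : R) := \int[borel_lebesgue n]_v h (cons_rV (t, v)).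
have mH : measurable_fun [set: Rm] H by exact: measurable_fun_integral_cons_rV.
have H0 t : 0 <= H t by exact: integral_ge0.
transitivity (\int[lebesgue_measure]_t ((c ^- n)%:E * H (c * t)%R)).
  apply: eq_integral => t _; rewrite /H -IH//; last exact: measurable_fun_cons_rV2.
  apply: eq_integral => v _; congr h.
  by rewrite -cons_rVZ.
have cn0 : (0 <= c ^- n)%R by rewrite invr_ge0 exprn_ge0// ltW.
have mHc : measurable_fun [set: Rm] (fun t => H (c * t)%R).
  by apply: (measurableT_comp mH); exact: (@measurable_funM _ _ R).
rewrite ge0_integralZl; last 4 first.
- exact: measurableT.
- exact: mHc.
- by move=> t _; exact: H0.
- by rewrite lee_fin.
rewrite ge0_integral_scale1// muleA -EFinM; congr (_%:E * _).
by rewrite exprS invfM mulrC.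
Qed.

End affine_change_of_variables.

(** * The Euclidean norm, Borel sets and the measure of balls *)

Section euclidean_norm.
Context {R : realType} {n : nat}.
Implicit Types x y z : 'rV[R]_n.

Lemma enorm_ge0 x : 0 <= enorm x. Proof. exact: sqrtr_ge0. Qed.

Lemma enorm_sumsq_ge0 x : 0 <= \sum_(i < n) x ord0 i ^+ 2.
Proof. by apply: sumr_ge0 => i _; exact: sqr_ge0. Qed.

Lemma sqr_enorm x : enorm x ^+ 2 = \sum_(i < n) x ord0 i ^+ 2.
Proof. exact/sqr_sqrtr/enorm_sumsq_ge0. Qed.

Lemma enormN x : enorm (- x) = enorm x.
Proof. by congr Num.sqrt; apply: eq_bigr => i _; rewrite mxE sqrrN. Qed.

Lemma enormB x y : enorm (x - y) = enorm (y - x).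
Proof. by rewrite -enormN opprB. Qed.

Lemma enorm0 : enorm (0 : 'rV[R]_n) = 0.
Proof. by rewrite /enorm big1 ?sqrtr0// => i _; rewrite mxE expr0n. Qed.

Lemma enormZ c x : 0 <= c -> enorm (c *: x) = c * enorm x.
Proof.
move=> c0; apply: (@pexpIrn _ 2) => //.
- by rewrite nnegrE enorm_ge0.
- by rewrite nnegrE mulr_ge0 ?enorm_ge0.
- rewrite exprMn !sqr_enorm mulr_sumr.
  by apply: eq_bigr => i _; rewrite mxE exprMn.
Qed.

Lemma coord_le_enorm x i : `|x ord0 i| <= enorm x.
Proof.
rewrite -sqrtr_sqr ler_sqrt ?enorm_sumsq_ge0// (bigD1 i)//= lerDl.
by apply: sumr_ge0 => j _; exact: sqr_ge0.
Qed.

(** Cauchy-Schwarz, from the nonnegativity of the sum of the squared minors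
    [x_i y_j - x_j y_i]. *)
Lemma sum_mul_le_enorm x y :
  \sum_(i < n) x ord0 i * y ord0 i <= enorm x * enorm y.
Proof.
have [d_lt0|d_ge0] := ltP (\sum_(i < n) x ord0 i * y ord0 i) 0.
  by rewrite (le_trans (ltW d_lt0))// mulr_ge0 ?enorm_ge0.
rewrite -(@ler_pXn2r _ 2)//; last by rewrite nnegrE mulr_ge0 ?enorm_ge0.
rewrite exprMn !sqr_enorm -subr_ge0.
set a := fun i => x ord0 i; set b := fun i => y ord0 i.
have : 0 <= \sum_(i < n) \sum_(j < n) (a i * b j - a j * b i) ^+ 2.
  by apply: sumr_ge0 => i _; apply: sumr_ge0 => j _; exact: sqr_ge0.
suff -> : \sum_(i < n) \sum_(j < n) (a i * b j - a j * b i) ^+ 2 =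
   2 * ((\sum_(i < n) a i ^+ 2) * (\sum_(i < n) b i ^+ 2) -
        (\sum_(i < n) a i * b i) ^+ 2).
  by rewrite pmulr_rge0.
have sqr_minor i j : (a i * b j - a j * b i) ^+ 2 =
    a i ^+ 2 * b j ^+ 2 + (b i ^+ 2 * a j ^+ 2 - 2 * ((a i * b i) * (a j * b j))).
  by ring.
have E (u v : 'I_n -> R) : \sum_i \sum_j u i * v j = (\sum_i u i) * (\sum_i v i).
  by rewrite mulr_suml; apply: eq_bigr => i _; rewrite mulr_sumr.
transitivity (\sum_i \sum_j a i ^+ 2 * b j ^+ 2 + (\sum_i \sum_j b i ^+ 2 * a j ^+ 2
    - \sum_i \sum_j (2 * (a i * b i)) * (a j * b j))).
  rewrite -sumrB -big_split; apply: eq_bigr => i _.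
  rewrite -sumrB -big_split; apply: eq_bigr => j _.
  by rewrite sqr_minor mulrA.
rewrite !E -mulr_sumr expr2; ring.
Qed.

Lemma enormD x y : enorm (x + y) <= enorm x + enorm y.
Proof.
rewrite -(@ler_pXn2r _ 2)// ?nnegrE ?addr_ge0 ?enorm_ge0//.
rewrite sqrrD !sqr_enorm.
rewrite [leLHS](_ : _ = \sum_(i < n) x ord0 i ^+ 2 +
  (\sum_(i < n) x ord0 i * y ord0 i) *+ 2 + \sum_(i < n) y ord0 i ^+ 2).
  by rewrite lerD2r lerD2l lerMn2r/= sum_mul_le_enorm.
rewrite -sumrMnl -!big_split/=; apply: eq_bigr => i _.
by rewrite mxE sqrrD.
Qed.

Lemma enorm_triangle y x z : enorm (x - z) <= enorm (x - y) + enorm (y - z).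
Proof. by rewrite (le_trans _ (enormD _ _))// addrA subrK. Qed.

Lemma enorm_eq0 x : enorm x = 0 -> x = 0.
Proof.
move=> x0; apply/rowP => i; rewrite mxE; apply/eqP.
by rewrite -normr_eq0 eq_le normr_ge0 -x0 coord_le_enorm.
Qed.

Lemma enorm_gt0 x y : x != y -> 0 < enorm (x - y).
Proof.
move=> xy; rewrite lt_neqAle enorm_ge0 andbT eq_sym.
by apply: contra_neq xy => /enorm_eq0/subr0_eq.
Qed.

Lemma enorm_lt r x : 0 < r -> (forall i, `|x ord0 i| < r) -> enorm x < n.+1%:R * r.
Proof.
move=> r0 xr; rewrite -(@ltr_pXn2r _ 2)// ?nnegrE ?enorm_ge0 ?mulr_ge0// ?ltW//.
rewrite sqr_enorm.
apply: (@le_lt_trans _ _ (\sum_(i < n) r ^+ 2)).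
  apply: ler_sum => i _; rewrite -real_normK ?num_real//.
  by rewrite lerXn2r ?nnegrE// ltW.
rewrite sumr_const card_ord -[ltLHS]mulr_natl exprMn ltr_pM2r ?exprn_gt0//.
by rewrite -natrX ltr_nat expnS expn1 (@leq_trans n.+1)// leq_pmulr.
Qed.

End euclidean_norm.

(** Cubes centred at the origin, i.e., balls of the sup norm; averages over
    them are what the maximal operator below is built on. *)
Definition cube {R : realType} {n : nat} (r : R) : set 'rV[R]_n :=
  [set z | forall i, `|z ord0 i| < r].

Section borel_sets.
Context {R : realType} {n : nat}.
Local Notation Rm := (measurableTypeR R).
Local Notation X := 'rV[Rm]_n.

Lemma measurable_forall_ord d (T : measurableType d) m (P : 'I_m -> set T) :
  (forall i, measurable (P i)) -> measurable [set z | forall i, P i z].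
Proof.
move=> mP; rewrite (_ : [set z | _] = \bigcap_(i in [set: 'I_m]) P i).
  by apply: fin_bigcap_measurable => //; exact: finite_finset.
by apply/seteqP; split => [z Pz i _|z Pz i]; [exact: Pz|exact: Pz].
Qed.

Lemma measurable_ball_rV (x : 'rV[R]_n) r :
  measurable ([set y | forall i, `|x ord0 i - y ord0 i| < r] : set X).
Proof.
apply: (@measurable_forall_ord _ X n (fun i => [set y | `|x ord0 i - y ord0 i| < r])) => i.
pose f (y : X) : R := `|x ord0 i - y ord0 i|.
have mf : measurable_fun [set: X] f.
  apply: (measurableT_comp (@normr_measurable R setT)).
  apply: measurable_funB; first exact: measurable_cst.
  exact: measurable_coord_rV.
rewrite [X in measurable X](_ : _ = f @^-1` `]-oo, r[).
  by rewrite -[X in measurable X]setTI; exact: mf.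
by apply/seteqP; split => y /=; rewrite in_itv.
Qed.

Lemma measurable_cube r : measurable (cube r : set X).
Proof.
rewrite (_ : cube r = [set y | forall i, `|(0 : 'rV[R]_n) ord0 i - y ord0 i| < r]).
  exact: measurable_ball_rV.
by apply/seteqP; split => y /= H i; move: (H i); rewrite mxE sub0r normrN.
Qed.

Lemma measurable_enorm d (T : measurableType d) (f : T -> X) :
  measurable_fun setT f -> measurable_fun setT (fun t => enorm (f t : 'rV[R]_n)).
Proof.
move=> mf; apply: (measurableT_comp (continuous_measurable_fun (@sqrt_continuous R))).
apply: measurable_sum => i.
apply: measurable_funX; exact: (measurableT_comp (measurable_coord_rV i)).
Qed.

Lemma measurable_eball (x : 'rV[R]_n) r : measurable (eball x r : set X).
Proof.
pose f (y : X) : R := enorm (x - (y : 'rV[R]_n)).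
have mf : measurable_fun [set: X] f.
  apply: measurable_enorm.
  by apply: (@measurable_subV R); [exact: measurable_cst|exact: measurable_id].
rewrite (_ : eball x r = f @^-1` `]-oo, r[).
  by rewrite -[X in measurable X]setTI; exact: mf.
by apply/seteqP; split => y /=; rewrite in_itv.
Qed.

Lemma rat_rV_dense (x : 'rV[R]_n) (e : R) : 0 < e ->
  exists q : 'rV[rat]_n, forall i, `|ratr (q ord0 i) - x ord0 i| < e.
Proof.
move=> e0.
have /choice[c xc] i : exists q : rat, `|ratr q - x ord0 i| < e.
  have lt_itv : x ord0 i - e < x ord0 i + e by rewrite ltrBlDr -addrA ltrDl addr_gt0.
  have [p] := rat_in_itvoo lt_itv.
  by rewrite in_itv /= -ltr_distl => ?; exists p.
by exists (\row_i c i) => i; rewrite mxE.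
Qed.

Lemma nbhs_rVP (x : 'rV[R]_n) (G : set 'rV[R]_n) : nbhs x G <->
  exists2 e, 0 < e & forall y : 'rV[R]_n, (forall i, `|x ord0 i - y ord0 i| < e) -> G y.
Proof.
split=> [/nbhs_ballP[e e0 xG]|[e e0 xG]].
  exists e => // y xy; apply: xG; split => // i j; rewrite [i]ord1; exact: xy.
by apply/nbhs_ballP; exists e => // y [_ xy]; apply: xG => i; exact: xy.
Qed.

(** Every open set is the union of the sup balls of rational centre and of
    radius the inverse of an integer that it contains. *)
Lemma open_measurable_rV (G : set 'rV[R]_n) : open G -> measurable (G : set X).
Proof.
move=> oG.
pose q (c : 'rV[rat]_n) : 'rV[R]_n := map_mx ratr c.
pose Q (c : 'rV[rat]_n) (k : nat) : set 'rV[R]_n :=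
  [set y | forall i, `|q c ord0 i - y ord0 i| < k.+1%:R^-1].
pose F (p : 'rV[rat]_n * nat) : set X := if `[< Q p.1 p.2 `<=` G >] then Q p.1 p.2 else set0.
rewrite (_ : G = \bigcup_p F p).
  apply: countable_bigcupT_measurable => [|p]; first exact: countableP.
  rewrite /F; case: ifP => // _; exact: measurable_ball_rV.
apply/seteqP; split => [x Gx|x [p _]]; last first.
  by rewrite /F; case: ifPn => // /asboolP; apply.
have /nbhs_rVP[e e0 xG] : nbhs x G by apply: open_nbhs_nbhs; split.
have k0 k : 0 < k.+1%:R^-1 :> R by rewrite invr_gt0.
have [k ke] : exists k, k.+1%:R^-1 < e / 2.
  have [k _ /(_ k (leqnn k)) /= ke] := near_infty_natSinv_lt (PosNum (divr_gt0 e0 (ltr0n _ 2))).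
  by exists k.
have [c xc] := rat_rV_dense x (k0 k).
exists (c, k) => //; rewrite /F; case: ifPn => [_ i|/asboolP/=]; first by rewrite mxE.
apply: contra_notP => _ y Qy; apply: xG => i.
have := Qy i; have := xc i; rewrite !mxE distrC => xci Qyi.
rewrite (le_lt_trans (ler_distD (ratr (c ord0 i)) _ _))//.
by rewrite [e]splitr ltrD// (lt_trans _ ke).
Qed.

End borel_sets.

Section measure_of_balls.
Context {R : realType}.
Local Notation Rm := (measurableTypeR R).
Local Notation X n := 'rV[Rm]_n.

Lemma cube_cons_rV n (r : R) :
  @cons_rV Rm n @^-1` (cube r) = [set` `]-r, r[%R] `*` (cube r : set (X n)).
Proof.
apply/seteqP; split => [[t v] /= rtv|[t v] /= [rt rv] i].
  split => /=.
    by rewrite in_itv/= -ltr_norml; have := rtv ord0; rewrite -[Y in `|Y|]/((uncons_rV (cons_rV (t, v))).1) cons_rVK.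
  move=> i; have := rtv (lift ord0 i).
  have <- : (uncons_rV (cons_rV (t, v))).2 ord0 i = cons_rV (t, v) ord0 (lift ord0 i) by rewrite mxE.
  by rewrite cons_rVK.
rewrite /cons_rV mxE; case: splitP => j _; rewrite ?mxE//=.
by rewrite ltr_norml; rewrite in_itv in rt.
Qed.

Lemma measure_cube n (r : R) : 0 < r ->
  borel_lebesgue n (cube r) = ((2 * r) ^+ n)%:E.
Proof.
move=> r0; elim: n => [|n IH].
  by rewrite expr0 /= diracE mem_set// => -[].
rewrite /= /borel_lebesgue_step /pushforward cube_cons_rV product_measure1E//=; last first.
  exact: measurable_cube.
rewrite IH lebesgue_measure_itv/= lte_fin ifT; last by lra.
by rewrite -EFinM exprS; congr (_ * _)%:E; ring.
Qed.

End measure_of_balls.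

Section integral_over_balls.
Context {R : realType} {n : nat}.
Local Notation Rm := (measurableTypeR R).
Local Notation X := 'rV[Rm]_n.
Local Notation mu := (@borel_lebesgue R n).
Implicit Types (h : 'rV[R]_n -> \bar R) (x : 'rV[R]_n).
Local Open Scope ereal_scope.

Lemma measurable_fun_translate h x : measurable_fun [set: X] h ->
  measurable_fun [set: X] (fun z => h (x + z)%R).
Proof. by move=> mh; apply: (measurableT_comp mh); exact: measurable_addrV. Qed.

Lemma ge0_integral_eball_translate h x (a : 'rV[R]_n) r : measurable_fun [set: X] h ->
  (forall z, 0 <= h z) ->
  \int[mu]_(y in eball (a + x)%R r) h y = \int[mu]_(z in eball x r) h (a + z)%R.
Proof.
move=> mh h0; rewrite integral_mkcond [RHS]integral_mkcond.
rewrite -(ge0_integral_translate a).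
- apply: eq_integral => z _; rewrite !patchE; congr (if _ then _ else _).
  by apply/idP/idP; rewrite !inE /eball/= opprD addrACA subrr add0r.
- by apply/(measurable_restrictT _ _).1; [exact: measurable_eball|exact: measurable_funTS].
- by move=> z; exact: erestrict_ge0.
Qed.

Lemma ge0_integral_eball h x r : measurable_fun [set: X] h -> (forall z, 0 <= h z) ->
  \int[mu]_(y in eball x r) h y = \int[mu]_(z in eball 0%R r) h (x + z)%R.
Proof.
move=> mh h0.
by have := @ge0_integral_eball_translate h 0%R x r mh h0; rewrite addr0.
Qed.

Lemma ge0_integral_eball_dilate h (c r : R) : (0 < c)%R ->
  measurable_fun [set: X] h -> (forall z, 0 <= h z) ->
  \int[mu]_(y in eball 0%R r) h (c *: y)%R =
    (c ^- n)%:E * \int[mu]_(z in eball 0%R (c * r)%R) h z.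
Proof.
move=> c0 mh h0; rewrite integral_mkcond [in RHS]integral_mkcond.
rewrite -ge0_integral_scale//.
- apply: eq_integral => z _; rewrite !patchE; congr (if _ then _ else _).
  apply/idP/idP; rewrite !inE /eball/= !sub0r -scalerN enormZ ?(ltW c0)//.
    by rewrite ltr_pM2l.
  by rewrite ltr_pM2l.
- by apply/(measurable_restrictT _ _).1; [exact: measurable_eball|exact: measurable_funTS].
- by move=> z; exact: erestrict_ge0.
Qed.

Lemma eball_sub_cube r : eball (0 : 'rV[R]_n) r `<=` cube r.
Proof. by move=> z /=; rewrite /eball/= sub0r enormN => zr i; exact: le_lt_trans (coord_le_enorm _ _) zr. Qed.

Lemma cube_sub_eball r : (0 < r)%R -> cube (n.+1%:R^-1 * r)%R `<=` eball (0 : 'rV[R]_n) r.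
Proof.
move=> r0 z /= zr; rewrite /eball/= sub0r enormN.
have := enorm_lt _ zr; rewrite mulrA divff ?pnatr_eq0// mul1r; apply.
by rewrite mulr_gt0.
Qed.

Definition ball_volume : R := fine (mu (eball 0%R 1%R)).

Lemma measure_eball0_fin r : mu (eball (0%R : 'rV[R]_n) r) \is a fin_num.
Proof.
have [r0|r0] := ltP 0%R r; last first.
  rewrite (_ : eball _ _ = set0) ?measure0//.
  by apply/seteqP; split => // z /=; rewrite /eball/= ltNge (le_trans r0)// enorm_ge0.
rewrite ge0_fin_numE//; apply: (@le_lt_trans _ _ (mu (cube r))).
  by apply: le_measure; rewrite ?inE; [exact: measurable_eball|exact: measurable_cube|exact: eball_sub_cube].
by rewrite measure_cube// ltry.
Qed.

Lemma ball_volume_gt0 : (0 < ball_volume)%R.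
Proof.
rewrite /ball_volume fine_gt0//; apply/andP; split; last first.
  by rewrite -ge0_fin_numE// measure_eball0_fin.
apply: (@lt_le_trans _ _ (mu (cube (n.+1%:R^-1 * 1)%R))).
  by rewrite measure_cube ?lte_fin ?exprn_gt0 ?mulr_gt0.
by apply: le_measure; rewrite ?inE; [exact: measurable_cube|exact: measurable_eball|exact: cube_sub_eball].
Qed.

Lemma measure_eball x r : (0 < r)%R -> mu (eball x r) = (r ^+ n * ball_volume)%:E.
Proof.
move=> r0.
have mE y s : measurable (eball y s : set X) by exact: measurable_eball.
rewrite -[LHS]mul1e -integral_cst// ge0_integral_eball//.
rewrite [LHS](_ : _ = \int[mu]_(y in eball 0%R r) cst 1 (r^-1 *: y)%R)//.
rewrite ge0_integral_eball_dilate ?invr_gt0// mulVf ?gt_eqF//.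
rewrite integral_cst// mul1e exprVn invrK /ball_volume EFinM fineK//.
exact: measure_eball0_fin.
Qed.

End integral_over_balls.
Arguments ball_volume R n : clear implicits.

(** * Maximal averages over cubes *)

Section averages_over_cubes.
Context {R : realType} {n : nat}.
Local Notation Rm := (measurableTypeR R).
Local Notation X := 'rV[Rm]_n.
Local Notation mu := (@borel_lebesgue R n).
Local Open Scope ereal_scope.
Implicit Types (phi : 'rV[R]_n -> \bar R).

Definition cube_avg (r : R) phi : \bar R :=
  ((2 * r) ^- n)%:E * \int[mu]_(z in cube r) phi z.

(** An enumeration of the positive rationals, in which the value 1 stands for
    the indices that code none.  Restricting the radii to a countable set makes
    every maximal function measurable, and costs only a dimensional factor (see
    [integral_cube_le_max_avg]). *)
Definition radius_seq (j : nat) : R :=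
  if unpickle j is Some q then if (0 < q :> rat)%R then ratr q else 1%R else 1%R.

Definition max_avg phi : \bar R := ereal_sup (range (fun j => cube_avg (radius_seq j) phi)).

Lemma radius_seq_gt0 j : (0 < radius_seq j)%R.
Proof.
rewrite /radius_seq; case: unpickle => // q; case: ifPn => // q0.
by rewrite ltr0q.
Qed.

Lemma radius_seq_dense r s : (0 <= r)%R -> (r < s)%R -> exists j, (r < radius_seq j < s)%R.
Proof.
move=> r0 rs; have [q] := rat_in_itvoo rs; rewrite in_itv/= => rqs.
exists (pickle q); rewrite /radius_seq pickleK ifT//.
by rewrite -(ltr0q R) (le_lt_trans r0)//; case/andP: rqs.
Qed.

Lemma cube_avg_ge0 r phi : (0 <= r)%R -> (forall z, 0 <= phi z) -> 0 <= cube_avg r phi.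
Proof.
move=> r0 phi0; rewrite mule_ge0 ?integral_ge0//.
by rewrite lee_fin invr_ge0 exprn_ge0// mulr_ge0.
Qed.

Lemma max_avg_ge0 phi : (forall z, 0 <= phi z) -> 0 <= max_avg phi.
Proof.
move=> phi0; apply: (@le_trans _ _ (cube_avg (radius_seq 0) phi)).
  by apply: cube_avg_ge0 => //; exact/ltW/radius_seq_gt0.
by apply: ereal_sup_ubound; exists 0%N.
Qed.

Lemma cube_avg_le r phi psi : (0 <= r)%R -> (forall z, 0 <= phi z) ->
  measurable_fun [set: X] phi -> measurable_fun [set: X] psi ->
  (forall z, phi z <= psi z) -> cube_avg r phi <= cube_avg r psi.
Proof.
move=> r0 phi0 mphi mpsi phipsi; rewrite lee_pmul//.
- by rewrite lee_fin invr_ge0 exprn_ge0// mulr_ge0.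
- by rewrite integral_ge0.
- apply: ge0_le_integral => //; [exact: measurable_cube|exact: measurable_funTS..].
Qed.

Lemma le_max_avg phi psi : (forall z, 0 <= phi z) ->
  measurable_fun [set: X] phi -> measurable_fun [set: X] psi ->
  (forall z, phi z <= psi z) -> max_avg phi <= max_avg psi.
Proof.
move=> phi0 mphi mpsi phipsi; apply: ge_ereal_sup => _ [j _ <-].
apply: (@le_trans _ _ (cube_avg (radius_seq j) psi)).
  by apply: cube_avg_le => //; exact/ltW/radius_seq_gt0.
by apply: ereal_sup_ubound; exists j.
Qed.

(** A radius of the sequence between [r] and [2 r] gives the factor [4 = 2 * 2]
    instead of the side [2 r] of the cube. *)
Lemma integral_cube_le_max_avg r phi : (0 < r)%R -> (forall z, 0 <= phi z) ->
  measurable_fun [set: X] phi ->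
  \int[mu]_(z in cube r) phi z <= ((4 * r) ^+ n)%:E * max_avg phi.
Proof.
move=> r0 phi0 mphi; have r2r : (r < 2 * r)%R by rewrite ltr_pMl// ltr1n.
have [j /andP[rj j2r]] := radius_seq_dense (ltW r0) r2r.
have j0 : (0 < 2 * radius_seq j)%R by rewrite mulr_gt0// radius_seq_gt0.
apply: (@le_trans _ _ (((2 * radius_seq j) ^+ n)%:E * cube_avg (radius_seq j) phi)).
  rewrite /cube_avg muleA -EFinM divff ?expf_neq0 ?gt_eqF// mul1e.
  apply: ge0_subset_integral => //; [exact: measurable_cube..|exact: measurable_funTS|].
  by move=> z zr i; exact: (lt_trans (zr i)).
rewrite lee_pmul//.
- by rewrite lee_fin exprn_ge0// ltW.
- by apply: cube_avg_ge0 => //; exact/ltW/radius_seq_gt0.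
- rewrite lee_fin lerXn2r ?nnegrE ?(ltW j0)// ?mulr_ge0// ?(ltW r0)//.
  by rewrite (_ : 4 * r = 2 * (2 * r))%R ?ler_pM2l ?(ltW j2r)//; ring.
- by apply: ereal_sup_ubound; exists j.
Qed.

Lemma integral_eball_le_max_avg r phi : (0 < r)%R -> (forall z, 0 <= phi z) ->
  measurable_fun [set: X] phi ->
  \int[mu]_(z in eball 0%R r) phi z <= ((4 * r) ^+ n)%:E * max_avg phi.
Proof.
move=> r0 phi0 mphi; apply: le_trans (integral_cube_le_max_avg r0 phi0 mphi).
apply: ge0_subset_integral => //; [exact: measurable_eball|exact: measurable_cube|
  exact: measurable_funTS|exact: eball_sub_cube].
Qed.

Lemma max_avg_cst_le (t : R) : (0 <= t)%R -> max_avg (cst t%:E) <= t%:E.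
Proof.
move=> t0; apply: ge_ereal_sup => _ [j _ <-].
have j0 : (0 < 2 * radius_seq j)%R by rewrite mulr_gt0// radius_seq_gt0.
rewrite /cube_avg integral_cst; last exact: measurable_cube.
rewrite [Z in _ * (_ * Z)](measure_cube n (radius_seq_gt0 j)) -!EFinM lee_fin mulrCA mulVf ?mulr1//.
by rewrite expf_neq0// gt_eqF.
Qed.

Lemma max_avgD_le phi psi : (forall z, 0 <= phi z) -> (forall z, 0 <= psi z) ->
  measurable_fun [set: X] phi -> measurable_fun [set: X] psi ->
  max_avg (phi \+ psi) <= max_avg phi + max_avg psi.
Proof.
move=> phi0 psi0 mphi mpsi; apply: ge_ereal_sup => _ [j _ <-].
have j0 : (0 < 2 * radius_seq j)%R by rewrite mulr_gt0// radius_seq_gt0.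
rewrite /cube_avg ge0_integralD//; last 3 first.
- exact: measurable_cube.
- exact: measurable_funTS.
- exact: measurable_funTS.
rewrite ge0_muleDr ?integral_ge0// leeD//; by apply: ereal_sup_ubound; exists j.
Qed.

Section measurability_in_a_parameter.
Context d (T : measurableType d) (Phi : T * 'rV[R]_n -> \bar R).
Hypothesis mPhi : measurable_fun [set: T * X] Phi.
Hypothesis Phi0 : forall w, 0 <= Phi w.

Lemma measurable_fun_integral_param (D : set X) : measurable D ->
  measurable_fun setT (fun t => \int[mu]_(z in D) Phi (t, z)).
Proof.
move=> mD; under eq_fun do rewrite integral_mkcond.
pose Psi := Phi \_ ([set: T] `*` D).
have mPsi : measurable_fun [set: T * X] Psi.
  by apply/(measurable_restrictT _ _).1; [exact: measurableX|exact: measurable_funTS].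
have Psi0 w : 0 <= Psi w by exact: erestrict_ge0.
rewrite (_ : (fun t => _) = fubini_F mu Psi).
  exact: measurable_fun_fubini_tonelli_F.
apply/funext => t; apply: eq_integral => z _; rewrite /Psi !patchE.
by congr (if _ then _ else _); apply/idP/idP; rewrite !inE /=; [split|case].
Qed.

Lemma measurable_fun_max_avg : measurable_fun setT (fun t => max_avg (fun z => Phi (t, z))).
Proof.
apply: (measurability _ (ErealGenOInfty.measurableE R)) => _ [_ [a ->] <-].
rewrite setTI (_ : _ @^-1` _ = \bigcup_j [set t | a%:E < cube_avg (radius_seq j) (fun z => Phi (t, z))]).
  apply: bigcup_measurable => j _.
  rewrite -[Y in measurable Y]setTI; apply: emeasurable_fun_o_infty => //.
  apply: measurable_funeM; apply: measurable_fun_integral_param; exact: measurable_cube.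
apply/seteqP; split => t /=; rewrite in_itv/= andbT.
  by move=> /ereal_sup_gt[_ [j _ <-] ?]; exists j.
by move=> [j _ aj]; apply: lt_le_trans aj _; apply: ereal_sup_ubound; exists j.
Qed.

End measurability_in_a_parameter.

End averages_over_cubes.

(** * The weak-type inequality *)

Section weak_type.
Context {R : realType} {n : nat}.
Local Notation Rm := (measurableTypeR R).
Local Notation X := 'rV[Rm]_n.
Local Notation mu := (@borel_lebesgue R n).
Local Open Scope ereal_scope.
Implicit Types (u : 'rV[R]_n -> \bar R) (c x : 'rV[R]_n).

Definition max_fun u x : \bar R := max_avg (fun z => u (x + z)%R).

Lemma measurable_fun_add u : measurable_fun [set: X] u ->
  measurable_fun [set: X * X] (fun w : 'rV[R]_n * 'rV[R]_n => u (w.1 + w.2)%R).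
Proof.
move=> mu'; apply: (measurableT_comp mu').
by apply: measurable_addrV; [exact: measurable_fst|exact: measurable_snd].
Qed.

Lemma measurable_max_fun u : measurable_fun [set: X] u -> (forall x, 0 <= u x) ->
  measurable_fun [set: X] (max_fun u).
Proof.
move=> mu' u0.
exact: (measurable_fun_max_avg (measurable_fun_add mu') (fun w => u0 _)).
Qed.

Let tcube c r : set 'rV[R]_n := [set y | cube r (y - c)%R].

Let measurable_tcube c r : measurable (tcube c r : set X).
Proof.
rewrite (_ : tcube c r = [set y | forall i, `|c ord0 i - y ord0 i| < r]%R).
  exact: measurable_ball_rV.
by apply/seteqP; split => y yr i; have := yr i; rewrite !mxE distrC.
Qed.

Let measure_tcube c r : (0 < r)%R -> mu (tcube c r) = ((2 * r) ^+ n)%:E.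
Proof.
move=> r0; have mc := measurable_tcube c r.
rewrite -[LHS]mul1e -integral_cst// integral_mkcond.
rewrite -(ge0_integral_translate c); last 2 first.
- by apply/(measurable_restrictT _ _).1 => //; exact: measurable_funTS.
- by move=> z; apply: erestrict_ge0 => //.
rewrite -[RHS](measure_cube n r0) -[RHS]mul1e -integral_cst; last exact: measurable_cube.
rewrite [RHS]integral_mkcond; apply: eq_integral => z _; rewrite !patchE.
by congr (if _ then _ else _); apply/idP/idP; rewrite !inE /tcube/= addrAC subrr add0r.
Qed.

Let integral_tcube u c r : measurable_fun [set: X] u -> (forall x, 0 <= u x) ->
  \int[mu]_(y in tcube c r) u y = \int[mu]_(z in cube r) u (c + z)%R.
Proof.
move=> mu' u0; have mc := measurable_tcube c r.
rewrite integral_mkcond -(ge0_integral_translate c); last 2 first.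
- by apply/(measurable_restrictT _ _).1 => //; exact: measurable_funTS.
- by move=> z; apply: erestrict_ge0 => //.
rewrite [RHS]integral_mkcond; apply: eq_integral => z _; rewrite !patchE.
by congr (if _ then _ else _); apply/idP/idP; rewrite !inE /tcube/= addrAC subrr add0r.
Qed.

Let level (s : seq R) u (t : R) : set X :=
  [set x | exists2 r, r \in s & t%:E < cube_avg r (fun z => u (x + z)%R)].

Let measurable_level1 u t r : measurable_fun [set: X] u -> (forall x, 0 <= u x) ->
  measurable ([set x | t%:E < cube_avg r (fun z => u (x + z)%R)] : set X).
Proof.
move=> mu' u0; rewrite -[Y in measurable Y]setTI; apply: emeasurable_fun_o_infty => //.
apply: measurable_funeM.
exact: (measurable_fun_integral_param (measurable_fun_add mu') (fun w => u0 _) (measurable_cube r)).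
Qed.

Let levelE s u t : level s u t =
  \big[setU/set0]_(r <- s) [set x | t%:E < cube_avg r (fun z => u (x + z)%R)].
Proof.
rewrite -bigcup_seq; apply/seteqP; split => x.
  by move=> [r rs h]; exists r.
by move=> [r rs h]; exists r.
Qed.

Let measurable_level s u t : measurable_fun [set: X] u -> (forall x, 0 <= u x) ->
  measurable (level s u t).
Proof. by move=> mu' u0; rewrite levelE; apply: bigsetU_measurable => r _; exact: measurable_level1. Qed.

(** Of the cubes of a fixed radius centred in a set [A], a maximal disjoint
    family has the property that every other cube of that radius meets it.
    Distinct members contain distinct rational points, so that the family can
    be listed as a sequence of sets of centres with at most one element. *)
Let maximal_disjoint_cubes (A : set 'rV[R]_n) (r : R) : (0 < r)%R ->
  exists D : nat -> set 'rV[R]_n,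
  [/\ forall i c c', D i c -> D i c' -> c = c',
      forall i, D i `<=` A,
      trivIset setT (fun i => \bigcup_(c in D i) tcube c r) &
      forall x, A x -> exists i c, D i c /\ tcube c r `&` tcube x r !=set0].
Proof.
move=> r0.
have [D [DA tD maxD]] := ex_maximal_disjoint_subcollection (tcube^~ r) A.
have /choice[q qc] c : exists q : 'rV[rat]_n, tcube c r (map_mx ratr q).
  by have [q qc] := rat_rV_dense c r0; exists q => i; rewrite !mxE.
exists (fun i => [set c | D c /\ pickle (q c) = i]); split.
- move=> i c c' [Dc ci] [Dc' c'i]; apply: tD => //.
  exists (map_mx ratr (q c)); split; first exact: qc.
  by rewrite (_ : q c = q c')//; apply: (pcan_inj pickleK); rewrite ci c'i.
- by move=> i c [/DA].
- move=> i j _ _ [y [[c [Dc ci] yc] [c' [Dc' cj] yc']]].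
  by rewrite -ci -cj (tD c c')//; exists y.
move=> x Ax; apply: contrapT => noi.
have hx c : D c -> ~ (tcube c r `&` tcube x r !=set0).
  by move=> Dc cx; apply: noi; exists (pickle (q c)), c.
have x_x : tcube x r x by move=> i; rewrite subrr mxE normr0.
apply: (maxD (x |` D)).
- split=> [y Dy|xDD]; first by right.
  by apply: (hx x (xDD x (or_introl erefl))); exists x.
- by move=> y [->//|/DA].
- move=> c c' [->|Dc] [->|Dc']//.
  + by rewrite setIC => /hx; exact.
  + by move=> /hx; exact.
  + exact: tD.
Qed.

(** The covering argument.  The cubes of largest radius [r] that witness a
    large average are thinned out to a disjoint family with union [W]; every
    witnessing cube that meets [W] has its centre in the union of the doubled
    cubes, and every other one has a smaller radius and does not see the part
    of [u] on [W], so that induction applies to [u] outside [W]. *)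
Let weak_type_finite (s : seq R) u (t : R) : (0 < t)%R -> sorted >=%R s ->
  (forall r, r \in s -> 0 < r)%R -> measurable_fun [set: X] u -> (forall x, 0 <= u x) ->
  t%:E * mu (level s u t) <= (2 ^+ n)%:E * \int[mu]_x u x.
Proof.
move=> t0; elim: s u => [|r s IH] u /= rs s0 mu' u0.
  rewrite (_ : level _ _ _ = set0) ?measure0 ?mule0.
    by rewrite mule_ge0 ?lee_fin ?exprn_ge0// integral_ge0.
  by apply/seteqP; split => x // [].
have r0 : (0 < r)%R by rewrite s0 ?mem_head.
have s_le_r r' : r' \in s -> (r' <= r)%R.
  by move=> r's; have /allP/(_ _ r's) := order_path_min (rev_trans le_trans) rs.
pose A : set 'rV[R]_n := [set x | t%:E < cube_avg r (fun z => u (x + z)%R)].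
have [D [D1 DA tD maxD]] := maximal_disjoint_cubes A r0.
pose W_ i : set X := \bigcup_(c in D i) tcube c r.
pose V_ i : set X := \bigcup_(c in D i) tcube c (2 * r).
pose W := \bigcup_i W_ i.
have mD i r' : measurable (\bigcup_(c in D i) tcube c r' : set X).
  have [[c Dc]|] := pselect (exists c, D i c).
    rewrite (_ : D i = [set c]) ?bigcup_set1//.
    by apply/seteqP; split => [c' Dc'|c' ->//]; exact: D1 Dc' Dc.
  by move=> /forallNP noc; rewrite bigcup0// => c /noc.
have mW : measurable W by apply: bigcup_measurable => i _; exact: mD.
pose v := u \_ (~` W).
have mv : measurable_fun [set: X] v.
  by apply/(measurable_restrictT _ _).1; [exact: measurableC|exact: measurable_funTS].
have v0 x : 0 <= v x by exact: erestrict_ge0.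
have level_sub : level (r :: s) u t `<=` (\bigcup_i V_ i) `|` level s v t.
  move=> x [r' r's tr'].
  have r'r : (r' <= r)%R by move: r's; rewrite in_cons => /predU1P[->//|/s_le_r].
  have [[y [yx [i _ [c Dc yc]]]]|noW] := pselect ((tcube x r' `&` W) !=set0).
    left; exists i => //; exists c => // j.
    have := yx j; have := yc j; rewrite !mxE => yc' yx'.
    have := ler_distD (y ord0 j) (x ord0 j) (c ord0 j).
    rewrite [`|x _ _ - y _ _|%R]distrC => xc.
    have : (`|y ord0 j - x ord0 j| < r)%R by exact: lt_le_trans r'r.
    by move: yc' xc; lra.
  right; exists r'.
    move: r's; rewrite in_cons => /predU1P[r'E|//]; exfalso; apply: noW.
    rewrite r'E in tr' *.
    have [i [c [Dc [y [yc yx]]]]] := maxD x tr'.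
    by exists y; split => //; exists i => //; exists c.
  move: tr'; rewrite /cube_avg (_ : \int[mu]_(z in cube r') u (x + z)%R =
    \int[mu]_(z in cube r') v (x + z)%R)//.
  apply: eq_integral => z; rewrite inE => zr'.
  rewrite /v patchE ifT// inE => Wz; apply: noW; exists (x + z)%R; split => //.
  by rewrite /tcube/= addrAC subrr add0r.
have mV : measurable (\bigcup_i V_ i) by apply: bigcup_measurable => i _; exact: mD.
have mL : measurable (level s v t) by exact: measurable_level.
apply: (@le_trans _ _ (t%:E * (mu (\bigcup_i V_ i) + mu (level s v t)))).
  rewrite lee_pmul2l ?fin_numE ?lte_fin//.
  apply: (@le_trans _ _ (mu ((\bigcup_i V_ i) `|` level s v t))).
    2: exact: measureU2.
  apply: le_measure => //; rewrite inE.
    exact: measurable_level.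
  exact: measurableU.
have t_ge0 : 0 <= t%:E by rewrite lee_fin ltW.
rewrite ge0_muleDr//.
have -> : \int[mu]_x u x = \int[mu]_(x in W) u x + \int[mu]_x v x.
  rewrite -[in LHS](setUv W) ge0_integral_setU//.
  - by congr (_ + _); rewrite /v -integral_mkcond.
  - exact: measurableC.
  - by rewrite setUv.
  - by apply/disj_setPCl.
rewrite ge0_muleDr ?integral_ge0//; apply: leeD; last first.
  apply: IH => //; first exact: path_sorted rs.
  by move=> r' r's; apply: s0; rewrite in_cons r's orbT.
rewrite ge0_integral_bigcup//; last 2 first.
- by move=> i; exact: mD.
- exact: measurable_funTS.
apply: (@le_trans _ _ (t%:E * \sum_(i <oo) mu (V_ i))).
  rewrite lee_pmul2l ?fin_numE ?lte_fin//.
  by apply: measure_sigma_subadditive => // i; exact: mD.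
rewrite -!nneseriesZl//; last by move=> i _; exact: integral_ge0.
apply: lee_nneseries => i; first by move=> _ _; rewrite mule_ge0.
move=> _.
have [[c Dc]|] := pselect (exists c, D i c); last first.
  move=> /forallNP noc; rewrite /V_ bigcup0 ?measure0 ?mule0.
    by rewrite mule_ge0 ?integral_ge0// lee_fin exprn_ge0.
  by move=> c /noc.
have -> : V_ i = tcube c (2 * r).
  rewrite /V_ (_ : D i = [set c]) ?bigcup_set1//.
  by apply/seteqP; split => [c' Dc'|c' ->//]; exact: D1 Dc' Dc.
have -> : W_ i = tcube c r.
  rewrite /W_ (_ : D i = [set c]) ?bigcup_set1//.
  by apply/seteqP; split => [c' Dc'|c' ->//]; exact: D1 Dc' Dc.
rewrite measure_tcube ?mulr_gt0// integral_tcube//.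
rewrite exprMn EFinM muleCA lee_pmul2l ?fin_numE ?lte_fin ?exprn_gt0//.
have r2n0 : (0 < (2 * r) ^+ n)%R by rewrite exprn_gt0 ?mulr_gt0.
have /ltW tA := DA _ _ Dc.
apply: (@le_trans _ _ (((2 * r) ^+ n)%:E * cube_avg r (fun z => u (c + z)%R))).
  by rewrite muleC lee_pmul2l ?fin_numE ?lte_fin.
by rewrite /cube_avg muleA -EFinM divff ?mul1e// gt_eqF.
Qed.

Lemma max_fun_weak_type u (t : R) : (0 < t)%R ->
  measurable_fun [set: X] u -> (forall x, 0 <= u x) ->
  t%:E * mu [set x | t%:E < max_fun u x] <= (2 ^+ n)%:E * \int[mu]_x u x.
Proof.
move=> t0 mu' u0.
pose s m : seq R := [seq radius_seq j | j <- iota 0 m].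
have s_gt0 m r : r \in s m -> (0 < r)%R by move=> /mapP[j _ ->]; exact: radius_seq_gt0.
pose F m := level (s m) u t.
have mF m : measurable (F m) by exact: measurable_level.
have -> : [set x | t%:E < max_fun u x] = \bigcup_m F m.
  apply/seteqP; split => x /=.
    move=> /ereal_sup_gt[_ [j _ <-] tj]; exists j.+1 => //.
    exists (radius_seq j); last exact: tj.
    by apply: map_f; rewrite mem_iota/= add0n.
  move=> [m _ [_ /mapP[j _ ->] tj]]; apply: lt_le_trans tj _.
  by apply: ereal_sup_ubound; exists j.
have mUF : measurable (\bigcup_m F m) by exact: bigcup_measurable.
have ndF : {homo F : k m / (k <= m)%N >-> (k <= m)%O}.
  move=> k m km; apply/subsetPset => x [_ /mapP[j jk ->] tj].
  exists (radius_seq j); last exact: tj.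
  apply: map_f; move: jk; rewrite !mem_iota !leq0n /= !add0n.
  by move=> /leq_trans; exact.
rewrite muleC -lee_pdivlMr//.
rewrite -(cvg_lim _ (nondecreasing_cvg_mu mF mUF ndF))//; apply: lime_le.
  by apply/cvg_ex; eexists; exact: (nondecreasing_cvg_mu mF mUF ndF).
apply: nearW => m /=; rewrite lee_pdivlMr// muleC.
(* The covering argument takes the radii in decreasing order. *)
have -> : F m = level (sort >=%R (s m)) u t.
  by apply/seteqP; split => x [r]; rewrite ?mem_sort => rs tr; exists r; rewrite ?mem_sort.
apply: weak_type_finite => //.
  by apply: sort_sorted => x y; exact: ge_total.
by move=> r; rewrite mem_sort; exact: s_gt0.
Qed.

End weak_type.

(** * The maximal theorem *)

Section dyadic_levels.
Context {R : realType}.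
Implicit Types (b q p : R).

Let pow2 b q i : 0 <= b -> (b * 2 ^+ i.+1) `^ q = (b * 2 ^+ i) `^ q * 2 `^ q.
Proof. by move=> b0; rewrite -powRM// ?mulr_ge0// exprSr mulrA. Qed.

Lemma powR2_gt1 q : 0 < q -> 1 < 2 `^ q :> R.
Proof.
move=> q0; have E : 1 = 1 `^ q :> R by rewrite powR1.
rewrite [ltLHS]E; apply: gt0_ltr_powR => //; rewrite ?nnegrE//.
by rewrite ltr1n.
Qed.

(** The terms below level [u] form a geometric progression, hence are dominated
    by the last one. *)
Lemma sum_dyadic_powR_le b q (u : R) m : 0 < b -> 0 < q ->
  \sum_(i < m) (b * 2 ^+ i < u)%R%:R * (b * 2 ^+ i) `^ q <=
    2 `^ q / (2 `^ q - 1) * u `^ q.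
Proof.
move=> b0 q0; set t : R := 2 `^ q; have t1 : 1 < t := powR2_gt1 q0.
have t1' : 0 < t - 1 by rewrite subr_gt0.
have geo k : \sum_(i < k) (b * 2 ^+ i < u)%R%:R * (b * 2 ^+ i) `^ q <=
    (b * 2 ^+ k) `^ q / (t - 1).
  elim: k => [|k IH]; first by rewrite big_ord0 divr_ge0 ?powR_ge0// ltW.
  rewrite big_ord_recr/= pow2 ?(ltW b0)// (le_trans (lerD IH (_ : _ <= (b * 2 ^+ k) `^ q)))//.
    by case: (_ < _); rewrite ?mul1r// mul0r powR_ge0.
  by rewrite le_eqVlt; apply/orP; left; apply/eqP; rewrite -/t; field; rewrite gt_eqF.
elim: m => [|m IH].
  by rewrite big_ord0 mulr_ge0 ?powR_ge0// divr_ge0 ?powR_ge0// ltW.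
rewrite big_ord_recr/=; case: (boolP (b * 2 ^+ m < u)) => [bu|_]; last by rewrite mul0r addr0.
rewrite mul1r (le_trans (lerD (geo m) (lexx _)))//.
have -> : (b * 2 ^+ m) `^ q / (t - 1) + (b * 2 ^+ m) `^ q =
    t / (t - 1) * (b * 2 ^+ m) `^ q by field; rewrite gt_eqF.
rewrite ler_wpM2l//; first by rewrite divr_ge0// ltW// powR_gt0.
have bm0 : 0 <= b * 2 ^+ m by rewrite mulr_ge0// ltW.
apply: ge0_ler_powR; rewrite ?nnegrE ?(ltW q0)//; last exact: ltW.
exact: le_trans bm0 (ltW bu).
Qed.

Local Open Scope ereal_scope.

(** A number above [2b] lies within a factor of two of some level [2b 2^i]; this
    is a discrete substitute for the layer-cake formula. *)
Lemma poweR_le_nneseries b p (w : \bar R) : (0 < b)%R -> (1 <= p)%R -> (2 * b)%:E < w ->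
  w `^ p <= \sum_(i <oo) ((4 * (b * 2 ^+ i)) `^ p * ((2 * (b * 2 ^+ i))%:E < w)%E%:R)%:E.
Proof.
move=> b0 p1; have p0 : (0 <= p)%R by exact: le_trans p1.
have term_ge0 (v : \bar R) i : 0 <= ((4 * (b * 2 ^+ i)) `^ p * ((2 * (b * 2 ^+ i))%:E < v)%E%:R)%:E.
  by rewrite lee_fin mulr_ge0// powR_ge0.
have fin (v : R) : (2 * b < v)%R ->
    (v `^ p)%:E <= \sum_(i <oo) ((4 * (b * 2 ^+ i)) `^ p * ((2 * (b * 2 ^+ i))%:E < v%:E)%E%:R)%:E.
  move=> bv.
  have exk : exists k, (v <= 2 * (b * 2 ^+ k))%R.
    exists (Num.trunc (v / b)).+1; rewrite mulrCA -ler_pdivrMl// mulrC.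
    rewrite (le_trans (ltW (truncnS_gt _)))// -exprS -natrX ler_nat.
    by rewrite (leq_trans (ltnW (ltn_expl _ (ltnSn 1))))// leq_pexp2l.
  have [[|k] vk kmin] := ex_minnP exk.
    by move: vk; rewrite expr0 mulr1 leNgt bv.
  have kv : (2 * (b * 2 ^+ k) < v)%R.
    by rewrite ltNge; apply/negP => /kmin; rewrite ltnn.
  apply: le_trans (nneseries_lim_ge k.+1 (fun n _ _ => term_ge0 v%:E n)).
  rewrite big_nat_recr//= (@le_trans _ _ ((4 * (b * 2 ^+ k)) `^ p)%:E)//.
    rewrite lee_fin; apply: ge0_ler_powR; rewrite ?nnegrE//.
    - by rewrite ltW// (lt_trans _ bv)// mulr_gt0.
    - by rewrite !mulr_ge0// ltW.
    - by rewrite (le_trans vk)// exprS; rewrite le_eqVlt; apply/orP; left; apply/eqP; ring.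
  by rewrite lte_fin kv mulr1 leeDr// sume_ge0// => i _; exact: term_ge0.
case: w => [v| |]//; first by rewrite lte_fin => /fin; rewrite poweR_EFin.
move=> _; rewrite [leRHS](_ : _ = +oo) ?leey//; apply/eqyP => r r0.
pose v := Num.max r (Num.max 1 (2 * b + 1))%R.
have bv : (2 * b < v)%R by rewrite !lt_max ltrDl ltr01 !orbT.
apply: (@le_trans _ _ (v `^ p)%:E).
  rewrite lee_fin (@le_trans _ _ v)//; first by rewrite le_max lexx.
  by apply: le1r_powR => //; rewrite !le_max lexx !orbT.
apply: le_trans (fin _ bv) _; apply: lee_nneseries => i; first by move=> _ _; exact: term_ge0.
move=> _; rewrite lee_fin ler_wpM2l ?powR_ge0//.
by case: (_ < v%:E) => //; rewrite ltry.
Qed.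

End dyadic_levels.

Section strong_type.
Context {R : realType} {n : nat}.
Local Notation Rm := (measurableTypeR R).
Local Notation X := 'rV[Rm]_n.
Local Notation mu := (@borel_lebesgue R n).
Local Open Scope ereal_scope.
Implicit Types (u : 'rV[R]_n -> \bar R).

Let trunc u (t : R) : 'rV[R]_n -> \bar R := u \_ [set x | t%:E < u x].

Let measurable_trunc u t : measurable_fun [set: X] u -> measurable_fun [set: X] (trunc u t).
Proof.
move=> mu'; apply/(measurable_restrictT _ _).1; last exact: measurable_funTS.
by rewrite -[Y in measurable Y]setTI; exact: emeasurable_fun_o_infty.
Qed.

(** At level [2t] only the part of [u] above [t] counts, since the rest
    contributes at most [t] to every average. *)
Let weak_type_trunc u t : (0 < t)%R -> measurable_fun [set: X] u -> (forall x, 0 <= u x) ->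
  t%:E * mu [set x | (2 * t)%:E < max_fun u x] <= (2 ^+ n)%:E * \int[mu]_x trunc u t x.
Proof.
move=> t0 mu' u0; have mt := measurable_trunc t mu'.
have t'0 x : 0 <= trunc u t x by exact: erestrict_ge0.
apply: le_trans (max_fun_weak_type t0 mt t'0).
rewrite lee_pmul2l ?fin_numE ?lte_fin//.
have mlev v s : measurable_fun [set: X] v -> (forall x, 0 <= v x) ->
    measurable ([set x | s%:E < max_fun v x] : set X).
  move=> mv v0; rewrite -[Y in measurable Y]setTI.
  by apply: emeasurable_fun_o_infty => //; exact: measurable_max_fun.
apply: le_measure; rewrite ?inE; [exact: mlev|exact: mlev|].
move=> x /=; apply: contraTT; rewrite -!leNgt => xt.
apply: (@le_trans _ _ (max_avg (fun z => trunc u t (x + z)%R) + max_avg (cst t%:E))).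
  apply: le_trans (max_avgD_le _ _ _ _) => //.
  - apply: le_max_avg => //.
    + exact: measurable_fun_translate.
    + by apply: emeasurable_funD => //; exact: measurable_fun_translate.
    move=> z /=; rewrite /trunc patchE; case: ifPn.
      by move=> _; rewrite leeDl// lee_fin ltW.
    by rewrite notin_setE/= add0e => /negP; rewrite -leNgt.
  - by move=> z /=; rewrite lee_fin ltW.
  - exact: measurable_fun_translate.
by rewrite mulr2n mulrDl mul1r EFinD leeD// max_avg_cst_le// ltW.
Qed.

(** The [p]-th power of the maximal function is cut into dyadic levels.  At the
    level [2 b 2^i] the weak type only sees the part of [u] above [b 2^i], and
    for a given [x] the levels [b 2^i] below [u x] sum up to a multiple of the
    power [p - 1] of [u x], which is where [p > 1] is needed. *)
Lemma max_fun_strong_type (p : R) : (1 < p)%R ->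
  exists2 C : R, (0 < C)%R & forall u, measurable_fun [set: X] u -> (forall x, 0 <= u x) ->
    \int[mu]_x (max_fun u x `^ p) <= C%:E * \int[mu]_x (u x `^ p).
Proof.
move=> p1; have p0 : (0 < p)%R by exact: lt_trans p1.
pose q := (p - 1)%R; have q0 : (0 < q)%R by rewrite subr_gt0.
pose t : R := (2 `^ q)%R.
have t1 : (1 < t)%R by exact: powR2_gt1.
pose K := (4 `^ p * 2 ^+ n * (t / (t - 1)))%R.
have K0 : (0 < K)%R.
  by rewrite !mulr_gt0 ?powR_gt0 ?exprn_gt0 ?invr_gt0 ?subr_gt0.
exists K => // u mu' u0.
have mM := measurable_max_fun mu' u0.
have M0 x : 0 <= max_fun u x by exact: max_avg_ge0.
have mMp : measurable_fun [set: X] (fun x => max_fun u x `^ p).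
  exact: (measurableT_comp (measurable_poweR p)).
have mup : measurable_fun [set: X] (fun x => u x `^ p).
  exact: (measurableT_comp (measurable_poweR p)).
have mlev s : measurable ([set x | s%:E < max_fun u x] : set X).
  rewrite -[Y in measurable Y]setTI.
  by apply: emeasurable_fun_o_infty.
(* It suffices to bound the integral over each set where the maximal function
   exceeds a positive constant. *)
suff bound (b : R) : (0 < b)%R ->
    \int[mu]_(x in [set x | (2 * b)%:E < max_fun u x]) (max_fun u x `^ p) <=
      K%:E * \int[mu]_x (u x `^ p).
  pose F (k : nat) : set X := [set x | (2 * k.+1%:R^-1)%:E < max_fun u x].
  have ndF : {homo F : k m / (k <= m)%N >-> (k <= m)%O}.
    move=> k m km; apply/subsetPset => x; apply: le_lt_trans.
    by rewrite lee_fin ler_pM2l// lef_pV2 ?posrE// ler_nat.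
  have cvF : \int[mu]_(x in F i) (max_fun u x `^ p) @[i --> \oo] -->
      \int[mu]_(x in \bigcup_i F i) (max_fun u x `^ p).
    apply: ge0_nondecreasing_set_cvg_integral => // [i|i|i x _].
    - exact: mlev.
    - exact: measurable_funTS.
    - exact: poweR_ge0.
  have -> : \int[mu]_x (max_fun u x `^ p) = \int[mu]_(x in \bigcup_i F i) (max_fun u x `^ p).
    rewrite [RHS]integral_mkcond; apply: eq_integral => x _; rewrite patchE.
    case: ifPn => //; rewrite notin_setE => noF.
    have -> : max_fun u x = 0; last by rewrite poweR0r// gt_eqF.
    apply/eqP; rewrite eq_le M0 andbT leNgt; apply/negP => Mx0; apply: noF.
    have [e e0 ex] : exists2 e : R, (0 < e)%R & (2 * e)%:E < max_fun u x.
      case: (max_fun u x) Mx0 => [v| |]//; last by exists 1%R => //; rewrite ltry.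
      by rewrite lte_fin => v0; exists (v / 4)%R; rewrite ?divr_gt0// lte_fin; lra.
    have [k _ /(_ k (leqnn k)) /= ke] := near_infty_natSinv_lt (PosNum e0).
    by exists k => //; rewrite /F/= (le_lt_trans _ ex)// lee_fin ler_pM2l// ltW.
  rewrite -(cvg_lim _ cvF)//; apply: lime_le.
    by apply/cvg_ex; eexists; exact: cvF.
  by apply: nearW => k; apply: bound; rewrite invr_gt0.
move=> b0.
have bi i : (0 < b * 2 ^+ i)%R by rewrite mulr_gt0 ?exprn_gt0.
pose c i : R := ((4 * (b * 2 ^+ i)) `^ p)%R.
have c0 i : (0 <= c i)%R by exact: powR_ge0.
pose L i : set X := [set x | (2 * (b * 2 ^+ i))%:E < max_fun u x].
apply: (@le_trans _ _ (\int[mu]_x \sum_(i <oo) (c i)%:E * (\1_(L i) x)%:E)).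
  rewrite [leLHS]integral_mkcond; apply: ge0_le_integral => //.
  - by move=> x _; apply: erestrict_ge0 => y _; exact: poweR_ge0.
  - by apply/(measurable_restrictT _ _).1 => //; exact: measurable_funTS.
  - apply: ge0_emeasurable_sum => [i x _ _|i _]; first by rewrite -EFinM lee_fin mulr_ge0.
    by apply: measurable_funeM; apply/measurable_EFinP; apply: measurable_indic; exact: mlev.
  - move=> x _; rewrite patchE; case: ifPn => [|_]; last first.
      by apply: nneseries_ge0 => i _ _; rewrite -EFinM lee_fin mulr_ge0.
    rewrite inE => /= bx; apply: le_trans (poweR_le_nneseries b0 (ltW p1) bx) _.
    apply: lee_nneseries => i; first by move=> _ _; rewrite lee_fin mulr_ge0// powR_ge0.
    by move=> _; rewrite -EFinM lee_fin /c indicE /L mem_setE.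
rewrite integral_nneseries//; last 2 first.
- by move=> i; apply: measurable_funeM; apply/measurable_EFinP; apply: measurable_indic; exact: mlev.
- by move=> i x _; rewrite -EFinM lee_fin mulr_ge0.
pose a i : R := (c i * (b * 2 ^+ i)^-1 * 2 ^+ n)%R.
have a0 i : (0 <= a i)%R by rewrite !mulr_ge0 ?exprn_ge0// invr_ge0 ltW.
have mtr i : measurable_fun [set: X] (trunc u (b * 2 ^+ i)) by exact: measurable_trunc.
have tr0 i x : 0 <= trunc u (b * 2 ^+ i) x by exact: erestrict_ge0.
apply: (@le_trans _ _ (\sum_(i <oo) \int[mu]_x ((a i)%:E * trunc u (b * 2 ^+ i) x))).
  apply: lee_nneseries => i.
    by move=> _ _; apply: integral_ge0 => x _; rewrite -EFinM lee_fin mulr_ge0.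
  move=> _; rewrite ge0_integralZl//; last 2 first.
  - by apply/measurable_EFinP; apply: measurable_indic; exact: mlev.
  - by rewrite lee_fin.
  have mLi : measurable (L i) by exact: mlev.
  rewrite integral_indic// setIT ge0_integralZl//; last by rewrite lee_fin.
  have -> : (c i)%:E = (c i / (b * 2 ^+ i))%:E * (b * 2 ^+ i)%:E.
    by rewrite -EFinM divfK// gt_eqF.
  rewrite /a [in leRHS]EFinM -!muleA lee_wpmul2l ?weak_type_trunc//.
  by rewrite lee_fin divr_ge0// ltW.
rewrite -integral_nneseries//; last 2 first.
- by move=> i; apply: measurable_funeM.
- by move=> i x _; rewrite mule_ge0// lee_fin.
rewrite -ge0_integralZl//; last 2 first.
- by move=> x _; exact: poweR_ge0.
- by rewrite lee_fin ltW.
apply: ge0_le_integral => //.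
- by move=> x _; apply: nneseries_ge0 => i _ _; rewrite mule_ge0// lee_fin.
- apply: ge0_emeasurable_sum => [i x _ _|i _]; first by rewrite mule_ge0// lee_fin.
  exact: measurable_funeM.
- exact: measurable_funeM.
move=> x _; have := u0 x; case ux : (u x) => [v| |]// v0; last first.
  by rewrite poweRyr ?gt_eqF// gt0_muley ?lte_fin// leey.
apply: lime_le.
  by apply: is_cvg_nneseries => i _ _; rewrite mule_ge0// lee_fin.
apply: nearW => m.
rewrite (_ : \sum_(0 <= i < m) _ = (4 `^ p * 2 ^+ n * v * 
    \sum_(i < m) (b * 2 ^+ i < v)%R%:R * (b * 2 ^+ i) `^ q)%:E).
  rewrite poweR_EFin -EFinM lee_fin -[(v `^ p)%R](mulr_powRB1 _ p0)// /K -/q.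
  rewrite (_ : _ * (v * _) = 4 `^ p * 2 ^+ n * v * (t / (t - 1) * v `^ q))%R; last by ring.
  rewrite ler_wpM2l ?sum_dyadic_powR_le//.
  by rewrite !mulr_ge0 ?powR_ge0 ?exprn_ge0.
rewrite big_mkord EFinM -sumEFin ge0_sume_distrr; last first.
  by move=> i _; rewrite lee_fin mulr_ge0 ?powR_ge0.
apply: eq_bigr => i _.
rewrite /trunc patchE ux (_ : (x \in _) = (b * 2 ^+ i < v)%R); last first.
  by apply/idP/idP; rewrite inE/= ux lte_fin.
case: ifPn => _; last by rewrite mul0r !mule0.
rewrite mul1r -!EFinM /a /c powRM ?(ltW (bi i))//; congr (_%:E).
rewrite -[((b * 2 ^+ i) `^ p)%R](mulr_powRB1 _ p0) ?(ltW (bi i))// -/q.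
by field; rewrite expf_neq0 ?gt_eqF.
Qed.

End strong_type.

(** * Maximal functions of a pair of points *)

Section maximal_functions_of_two_variables.
Context {R : realType} {n : nat}.
Local Notation Rm := (measurableTypeR R).
Local Notation X := 'rV[Rm]_n.
Local Notation V := 'rV[R]_n.
Local Notation mu := (@borel_lebesgue R n).
Local Open Scope ereal_scope.
Implicit Types (F : V * V -> \bar R).

Definition swap_args F : V * V -> \bar R := fun w => F (w.2, w.1).

(** The maximal functions of a function of a pair of points in which only the
    first point, only the second one, or both together are moved. *)
Definition max_fst F : V * V -> \bar R := fun w => max_avg (fun z => F (w.1 + z, w.2)%R).
Definition max_snd F : V * V -> \bar R := fun w => max_avg (fun z => F (w.1, w.2 + z)%R).
Definition max_diag F : V * V -> \bar R := fun w => max_avg (fun z => F (w.1 + z, w.2 + z)%R).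

Lemma max_fst_ge0 F : (forall w, 0 <= F w) -> forall w, 0 <= max_fst F w.
Proof. by move=> F0 w; exact: max_avg_ge0. Qed.

Lemma max_snd_ge0 F : (forall w, 0 <= F w) -> forall w, 0 <= max_snd F w.
Proof. by move=> F0 w; exact: max_avg_ge0. Qed.

Lemma max_diag_ge0 F : (forall w, 0 <= F w) -> forall w, 0 <= max_diag F w.
Proof. by move=> F0 w; exact: max_avg_ge0. Qed.

Lemma max_fstE F : max_fst F = swap_args (max_snd (swap_args F)).
Proof. by []. Qed.

Lemma measurable_swap_args F : measurable_fun [set: X * X] F ->
  measurable_fun [set: X * X] (swap_args F).
Proof.
move=> mF; apply: (measurableT_comp mF).
by apply: measurable_fun_pair; [exact: measurable_snd|exact: measurable_fst].
Qed.

Lemma measurable_max_snd F : measurable_fun [set: X * X] F -> (forall w, 0 <= F w) ->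
  measurable_fun [set: X * X] (max_snd F).
Proof.
move=> mF F0.
have mPhi : measurable_fun [set: (X * X) * X] (fun t : (V * V) * V => F (t.1.1, t.1.2 + t.2)%R).
  apply: (measurableT_comp mF); apply: measurable_fun_pair.
    exact: (measurableT_comp measurable_fst measurable_fst).
  apply: (@measurable_addrV R); last exact: measurable_snd.
  exact: (measurableT_comp measurable_snd measurable_fst).
exact: (measurable_fun_max_avg mPhi (fun w => F0 _)).
Qed.

Lemma measurable_max_fst F : measurable_fun [set: X * X] F -> (forall w, 0 <= F w) ->
  measurable_fun [set: X * X] (max_fst F).
Proof.
move=> mF F0; rewrite max_fstE.
exact: (measurable_swap_args (measurable_max_snd (measurable_swap_args mF) (fun w => F0 _))).
Qed.

Lemma measurable_max_diag F : measurable_fun [set: X * X] F -> (forall w, 0 <= F w) ->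
  measurable_fun [set: X * X] (max_diag F).
Proof.
move=> mF F0.
have mPhi : measurable_fun [set: (X * X) * X] (fun t : (V * V) * V => F (t.1.1 + t.2, t.1.2 + t.2)%R).
  apply: (measurableT_comp mF); apply: measurable_fun_pair.
    apply: (@measurable_addrV R); last exact: measurable_snd.
    exact: (measurableT_comp measurable_fst measurable_fst).
  apply: (@measurable_addrV R); last exact: measurable_snd.
  exact: (measurableT_comp measurable_snd measurable_fst).
exact: (measurable_fun_max_avg mPhi (fun w => F0 _)).
Qed.

Lemma measurable_integral_snd F : measurable_fun [set: X * X] F -> (forall w, 0 <= F w) ->
  measurable_fun [set: X] (fun x => \int[mu]_y F (x, y)).
Proof. by move=> mF F0; exact: (measurable_fun_fubini_tonelli_F _ mF F0). Qed.

Lemma measurable_poweR_comp d (T : measurableType d) (g : T -> \bar R) p :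
  measurable_fun setT g -> measurable_fun setT (fun t => g t `^ p).
Proof. by move=> mg; exact: (measurableT_comp (measurable_poweR p)). Qed.

Lemma integral2_swap F : measurable_fun [set: X * X] F -> (forall w, 0 <= F w) ->
  \int[mu]_x \int[mu]_y F (x, y) = \int[mu]_x \int[mu]_y F (y, x).
Proof.
move=> mF F0.
exact: (@fubini_tonelli _ _ X X R mu mu F mF F0).
Qed.

Lemma measurable_shear : measurable_fun [set: X * X]
  (fun w : V * V => (w.2, w.2 + w.1)%R : X * X).
Proof.
apply: measurable_fun_pair; first exact: measurable_snd.
by apply: (@measurable_addrV R); [exact: measurable_snd|exact: measurable_fst].
Qed.

Lemma integral2_shear F : measurable_fun [set: X * X] F -> (forall w, 0 <= F w) ->
  \int[mu]_x \int[mu]_y F (x, y) = \int[mu]_h \int[mu]_x F (x, x + h)%R.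
Proof.
move=> mF F0.
pose S (w : V * V) := F (w.2, w.2 + w.1)%R.
have mS : measurable_fun [set: X * X] S := measurableT_comp mF measurable_shear.
apply: (etrans _ (esym (integral2_swap mS (fun w => F0 _)))).
apply: eq_integral => x _; rewrite -(ge0_integral_translate x)//.
by apply: (measurableT_comp mF); exact: measurable_pair1.
Qed.

(** The maximal theorem in the second variable, integrated over the first. *)
Lemma max_snd_bound p (C : R) F : (0 < C)%R ->
  (forall u : V -> \bar R, measurable_fun [set: X] u -> (forall x, 0 <= u x) ->
    \int[mu]_x (max_fun u x `^ p) <= C%:E * \int[mu]_x (u x `^ p)) ->
  measurable_fun [set: X * X] F -> (forall w, 0 <= F w) ->
  \int[mu]_x \int[mu]_y (max_snd F (x, y) `^ p) <= C%:E * \int[mu]_x \int[mu]_y (F (x, y) `^ p).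
Proof.
move=> C0 strong mF F0.
have mFp := measurable_poweR_comp p mF.
have mI := measurable_integral_snd mFp (fun w => poweR_ge0 _ _).
rewrite -ge0_integralZl//; last 2 first.
- by move=> x _; apply: integral_ge0 => y _; exact: poweR_ge0.
- by rewrite lee_fin ltW.
apply: ge0_le_integral => //.
- by move=> x _; apply: integral_ge0 => y _; exact: poweR_ge0.
- apply: (measurable_integral_snd (F := fun w => max_snd F w `^ p)).
    exact: (measurable_poweR_comp _ (measurable_max_snd mF F0)).
  by move=> w; exact: poweR_ge0.
- exact: measurable_funeM.
- move=> x _; apply: (strong (fun y => F (x, y))) => //.
  by apply: (measurableT_comp mF); exact: measurable_pair1.
Qed.

Lemma max_fst_bound p (C : R) F : (0 < C)%R ->
  (forall u : V -> \bar R, measurable_fun [set: X] u -> (forall x, 0 <= u x) ->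
    \int[mu]_x (max_fun u x `^ p) <= C%:E * \int[mu]_x (u x `^ p)) ->
  measurable_fun [set: X * X] F -> (forall w, 0 <= F w) ->
  \int[mu]_x \int[mu]_y (max_fst F (x, y) `^ p) <= C%:E * \int[mu]_x \int[mu]_y (F (x, y) `^ p).
Proof.
move=> C0 strong mF F0.
rewrite (integral2_swap (F := fun w => max_fst F w `^ p)); last 2 first.
- exact: (measurable_poweR_comp _ (measurable_max_fst mF F0)).
- by move=> w; exact: poweR_ge0.
rewrite (integral2_swap (F := fun w => F w `^ p)); last 2 first.
- exact/measurable_poweR_comp.
- by move=> w; exact: poweR_ge0.
apply: (max_snd_bound (F := swap_args F)) => // [|w]; last exact: F0.
exact: measurable_swap_args.
Qed.

(** In the variables [x] and [h = y - x] the joint translation moves [x] alone. *)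
Lemma max_diag_bound p (C : R) F : (0 < C)%R ->
  (forall u : V -> \bar R, measurable_fun [set: X] u -> (forall x, 0 <= u x) ->
    \int[mu]_x (max_fun u x `^ p) <= C%:E * \int[mu]_x (u x `^ p)) ->
  measurable_fun [set: X * X] F -> (forall w, 0 <= F w) ->
  \int[mu]_x \int[mu]_y (max_diag F (x, y) `^ p) <= C%:E * \int[mu]_x \int[mu]_y (F (x, y) `^ p).
Proof.
move=> C0 strong mF F0.
rewrite (integral2_shear (F := fun w => max_diag F w `^ p)); last 2 first.
- exact: (measurable_poweR_comp _ (measurable_max_diag mF F0)).
- by move=> w; exact: poweR_ge0.
rewrite (integral2_shear (F := fun w => F w `^ p)); last 2 first.
- exact/measurable_poweR_comp.
- by move=> w; exact: poweR_ge0.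
pose S w := F (w.2, w.2 + w.1)%R.
have mS : measurable_fun [set: X * X] S := measurableT_comp mF measurable_shear.
have SE h x : max_diag F (x, x + h)%R = max_snd S (h, x).
  by congr max_avg; apply/funext => z; rewrite /S/= addrAC.
under eq_integral do under eq_integral do rewrite SE.
exact: (max_snd_bound C0 strong mS (fun w => F0 _)).
Qed.

End maximal_functions_of_two_variables.

(** The sum is at most twice the larger term. *)
Lemma poweRD_le (R : realType) (p : R) (a b : \bar R) : (0 <= p)%R ->
  (0 <= a)%E -> (0 <= b)%E ->
  ((a + b) `^ p <= (2 `^ p)%:E * (a `^ p + b `^ p))%E.
Proof.
move=> p0; wlog ab : a b / (a <= b)%E => [H|] a0 b0.
  case: (leP a b) => [ab|/ltW ba]; first exact: H.
  by rewrite addeC [X in (_ * X)%E]addeC; exact: H.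
apply: (@le_trans _ _ ((2%:E * b) `^ p)%E).
  apply: gt0_ler_poweR => //; rewrite ?in_itv/= ?leey ?andbT ?adde_ge0 ?mule_ge0//.
  by rewrite -[2%R]/(1 + 1)%R EFinD ge0_muleDl// !mul1e leeD.
by rewrite poweRM// poweR_EFin lee_wpmul2l ?lee_fin ?powR_ge0// leeDr// poweR_ge0.
Qed.

(** * The pointwise estimate *)

Section averages_over_balls.
Context {R : realType} {n : nat}.
Local Notation Rm := (measurableTypeR R).
Local Notation X := 'rV[Rm]_n.
Local Notation V := 'rV[R]_n.
Local Notation mu := (@borel_lebesgue R n).
Local Notation v := (ball_volume R n).
Local Open Scope ereal_scope.
Implicit Types (phi psi : V -> \bar R) (r s t : R).

Definition ball_avg r phi : \bar R :=
  ((r ^+ n * v)^-1)%:E * \int[mu]_(z in eball 0%R r) phi z.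

Let ball_avg_coef_gt0 r : (0 < r)%R -> (0 < (r ^+ n * v)^-1)%R.
Proof. by move=> r0; rewrite invr_gt0 mulr_gt0 ?exprn_gt0 ?ball_volume_gt0. Qed.

Let integrable_side phi r : measurable_fun [set: X] phi ->
  measurable_fun (eball (0%R : V) r : set X) phi.
Proof. exact: measurable_funTS. Qed.

Lemma ball_avg_ge0 r phi : (0 < r)%R -> (forall z, 0 <= phi z) -> 0 <= ball_avg r phi.
Proof.
move=> r0 phi0; rewrite mule_ge0 ?integral_ge0//.
by rewrite lee_fin ltW// ball_avg_coef_gt0.
Qed.

Lemma ball_avg_le r phi psi : (0 < r)%R -> (forall z, 0 <= phi z) ->
  measurable_fun [set: X] phi -> measurable_fun [set: X] psi ->
  (forall z, (enorm z < r)%R -> phi z <= psi z) -> ball_avg r phi <= ball_avg r psi.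
Proof.
move=> r0 phi0 mphi mpsi phipsi; rewrite lee_wpmul2l//.
  by rewrite lee_fin ltW// ball_avg_coef_gt0.
apply: ge0_le_integral => //; [exact: measurable_eball|exact: integrable_side..|].
by move=> z; rewrite /eball/= sub0r enormN; exact: phipsi.
Qed.

Lemma ball_avg_cst r (c : \bar R) : (0 < r)%R -> 0 <= c -> ball_avg r (cst c) = c.
Proof.
move=> r0 c0; rewrite /ball_avg integral_cst; last exact: measurable_eball.
rewrite [Z in _ * (_ * Z)](measure_eball 0%R r0) muleCA -EFinM mulVf ?mule1//.
by rewrite mulf_neq0 ?expf_neq0 ?gt_eqF ?ball_volume_gt0.
Qed.

Lemma ball_avgD r phi psi : (0 < r)%R -> (forall z, 0 <= phi z) -> (forall z, 0 <= psi z) ->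
  measurable_fun [set: X] phi -> measurable_fun [set: X] psi ->
  ball_avg r (fun z => phi z + psi z) = ball_avg r phi + ball_avg r psi.
Proof.
move=> r0 phi0 psi0 mphi mpsi.
rewrite /ball_avg ge0_integralD//; last 3 first.
- exact: measurable_eball.
- exact: integrable_side.
- exact: integrable_side.
by rewrite ge0_muleDr// integral_ge0.
Qed.

Lemma ball_avgZ r (k : R) phi : (0 < r)%R -> (0 <= k)%R -> (forall z, 0 <= phi z) ->
  measurable_fun [set: X] phi ->
  ball_avg r (fun z => k%:E * phi z) = k%:E * ball_avg r phi.
Proof.
move=> r0 k0 phi0 mphi.
rewrite /ball_avg ge0_integralZl ?lee_fin//; last 2 first.
- exact: measurable_eball.
- exact: integrable_side.
by rewrite muleCA.
Qed.

Lemma ball_avg_dilate r (c : R) phi : (0 < r)%R -> (0 < c)%R -> (forall z, 0 <= phi z) ->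
  measurable_fun [set: X] phi ->
  ball_avg r (fun z => phi (c *: z)%R) = ball_avg (c * r) phi.
Proof.
move=> r0 c0 phi0 mphi; rewrite /ball_avg ge0_integral_eball_dilate//.
by rewrite muleA -EFinM exprMn -mulrA [in RHS]invfM [(_^-1 * c ^- n)%R]mulrC.
Qed.

(** Averages over a ball, possibly off-centre, are controlled by the maximal
    average, at the cost of the [n]-th power of the ratio of the radii. *)
Lemma ball_avg_translate_le_max_avg r s (c : V) phi : (0 < r)%R ->
  (enorm c + r <= s)%R -> (forall z, 0 <= phi z) -> measurable_fun [set: X] phi ->
  ball_avg r (fun z => phi (c + z)%R) <= ((4 * s / r) ^+ n / v)%:E * max_avg phi.
Proof.
move=> r0 crs phi0 mphi.
have s0 : (0 < s)%R by apply: lt_le_trans crs; rewrite ltr_wpDl ?enorm_ge0.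
rewrite /ball_avg -ge0_integral_eball//.
apply: (@le_trans _ _ (((r ^+ n * v)^-1)%:E * (((4 * s) ^+ n)%:E * max_avg phi))).
  rewrite lee_wpmul2l ?lee_fin ?(ltW (ball_avg_coef_gt0 _))//.
  apply: le_trans (integral_eball_le_max_avg s0 phi0 mphi).
  apply: ge0_subset_integral => //; [exact: measurable_eball..|exact: integrable_side|].
  move=> z; rewrite /eball/= sub0r enormN => cz.
  apply: lt_le_trans crs; rewrite -[z](subrK c) addrC.
  by rewrite (le_lt_trans (enormD _ _))// ltrD2l enormB.
rewrite muleA -EFinM le_eqVlt; apply/orP; left; apply/eqP; congr (_%:E * _).
by rewrite expr_div_n invfM mulrC !mulrA.
Qed.

Lemma ball_avg_le_max_avg r phi : (0 < r)%R -> (forall z, 0 <= phi z) ->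
  measurable_fun [set: X] phi -> ball_avg r phi <= (4 ^+ n / v)%:E * max_avg phi.
Proof.
move=> r0 phi0 mphi.
have := ball_avg_translate_le_max_avg (c := 0%R) (s := r) r0 _ phi0 mphi.
rewrite enorm0 add0r lexx mulfK ?gt_eqF// => /(_ isT).
by under [in ball_avg _ _]eq_fun do rewrite add0r.
Qed.

End averages_over_balls.

Section pointwise_estimate.
Context {R : realType} {n : nat}.
Local Notation Rm := (measurableTypeR R).
Local Notation X := 'rV[Rm]_n.
Local Notation V := 'rV[R]_n.
Local Notation v := (ball_volume R n).
Variables (G : set V) (delta : V -> R).
Hypothesis delta_gt0 : forall x, G x -> 0 < delta x.
Hypothesis delta_lip : forall x y, delta x <= delta y + enorm (x - y).
Hypothesis eball_delta : forall x, G x -> eball x (delta x) `<=` G.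
Hypothesis mG : measurable (G : set X).
Variable g : V -> R.
Hypothesis g0 : forall x, 0 <= g x.
Hypothesis mg : measurable_fun [set: X] g.
Variable al : R.
Hypothesis al0 : 0 < al.

Local Open Scope ereal_scope.

Definition ball_max x : \bar R :=
  ereal_sup [set ball_avg r (fun z => (g (x + z)%R)%:E) | r in `]0%R, delta x[].

(** [F] stands for the difference quotient of [g] of order [al]. *)
Variable F : V * V -> \bar R.
Hypothesis mF : measurable_fun [set: X * X] F.
Hypothesis F0 : forall w, 0 <= F w.
Hypothesis le_F : forall a b D, G a -> G b -> (enorm (a - b) <= D)%R ->
  (g a)%:E <= (g b)%:E + (D `^ al)%:E * F (a, b).

Let mg' : measurable_fun [set: X] (fun z => (g z)%:E).
Proof. exact/measurable_EFinP. Qed.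

Let mg_tr x : measurable_fun [set: X] (fun z => (g (x + z)%R)%:E).
Proof. exact: (measurable_fun_translate x mg'). Qed.

Let g0' z : 0 <= (g z)%:E. Proof. by rewrite lee_fin. Qed.

Let mpair (H : V * V -> \bar R) (f1 f2 : V -> V) : measurable_fun [set: X * X] H ->
  measurable_fun [set: X] (f1 : X -> X) -> measurable_fun [set: X] (f2 : X -> X) ->
  measurable_fun [set: X] (fun z => H (f1 z, f2 z)).
Proof. by move=> mH m1 m2; apply: (measurableT_comp mH); exact: measurable_fun_pair. Qed.

Let mtr x : measurable_fun [set: X] (fun z : X => (x + z)%R : X).
Proof. exact: measurable_addrV. Qed.

Let mcst (x : V) : measurable_fun [set: X] (fun z : X => x : X).
Proof. exact: measurable_cst. Qed.

Let ball_avg_le_ball_max y r : (0 < r)%R -> (r < delta y)%R ->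
  ball_avg r (fun z => (g (y + z)%R)%:E) <= ball_max y.
Proof. by move=> r0 ry; apply: ereal_sup_ubound; exists r => //=; rewrite in_itv/= r0. Qed.

(** The losses of [ball_avg_translate_le_max_avg] for a centred ball and for a
    ball of radius [d] contained in one of radius [3 d]. *)
Let k4 : R := (4 ^+ n / v)%R.
Let k12 : R := (12 ^+ n / v)%R.
Let k4_ge0 : (0 <= k4)%R. Proof. by rewrite divr_ge0 ?exprn_ge0 ?ltW ?ball_volume_gt0. Qed.
Let k12_ge0 : (0 <= k12)%R. Proof. by rewrite divr_ge0 ?exprn_ge0 ?ltW ?ball_volume_gt0. Qed.

(** Radii comparable to the distance of the points: compare with the averages
    over small balls around [y].  The points [x + z] and [y + w] then vary
    independently, whence the composition of [max_fst] and [max_snd]. *)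
Let estimate_small x y r (d := enorm (x - y)) : G x -> G y -> (0 < d)%R ->
  (0 < r)%R -> (r < delta x)%R -> (r <= 3 * d)%R ->
  ball_avg r (fun z => (g (x + z)%R)%:E) <=
    ball_max y + ((5 * d) `^ al * k4 * k4)%:E * max_fst (max_snd F) (x, y).
Proof.
move=> Gx Gy d0 r0 rx r3d.
(* Balls of radius [e] around [y] are admissible, and too small to bring the
   distances of the points above [5 d]. *)
pose e := Num.min d (delta y / 2)%R.
have e0 : (0 < e)%R by rewrite lt_min d0 divr_gt0// delta_gt0.
have ed : (e <= d)%R by rewrite ge_min lexx.
have ey : (e < delta y)%R.
  by rewrite gt_min ltr_pdivrMr// ltr_pMr ?delta_gt0// ltr1n orbT.
have D0 : (0 <= (5 * d) `^ al)%R by exact: powR_ge0.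
have My0 : 0 <= ball_max y.
  by apply: le_trans (ball_avg_le_ball_max e0 ey); exact: ball_avg_ge0.
have step z : (enorm z < r)%R ->
    (g (x + z)%R)%:E <= ball_max y + ((5 * d) `^ al * k4)%:E * max_snd F (x + z, y)%R.
  move=> zr.
  have Gxz : G (x + z)%R.
    by apply: (eball_delta Gx); rewrite /eball/= opprD addrA subrr sub0r enormN (lt_trans zr).
  have mF2 : measurable_fun [set: X] (fun w => F (x + z, y + w)%R) by exact: (mpair mF (mcst (x + z)%R) (mtr y)).
  rewrite -[leLHS](@ball_avg_cst R n _ _ e0)//.
  apply: (@le_trans _ _ (ball_avg e (fun w => (g (y + w)%R)%:E +
     ((5 * d) `^ al)%:E * F (x + z, y + w)%R))).
    apply: ball_avg_le => //.
    - by move=> w; exact: g0'.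
    - by apply: emeasurable_funD => //; exact: measurable_funeM.
    move=> w we; apply: le_F => //.
      apply: (eball_delta Gy); rewrite /eball/= opprD addrA subrr sub0r enormN.
      exact: lt_trans ey.
    rewrite opprD addrACA (le_trans (enormD _ _))// -/d.
    have := enormD z (- w); rewrite enormN; lra.
  rewrite ball_avgD//; last 2 first.
  - by move=> w; rewrite mule_ge0.
  - exact: measurable_funeM.
  apply: leeD; first exact: ball_avg_le_ball_max.
  rewrite ball_avgZ// EFinM -muleA lee_wpmul2l ?lee_fin//.
  exact: ball_avg_le_max_avg.
have mS : measurable_fun [set: X] (fun z => max_snd F (x + z, y)%R).
  by exact: (mpair (measurable_max_snd mF F0) (mtr x) (mcst y)).
have S0 z : 0 <= max_snd F (x + z, y)%R by exact: max_snd_ge0.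
apply: (@le_trans _ _ (ball_avg r (fun z => ball_max y +
    ((5 * d) `^ al * k4)%:E * max_snd F (x + z, y)%R))).
  apply: ball_avg_le => [//|z|||z zr]; [exact: g0'|exact: mg_tr| |exact: step].
  by apply: emeasurable_funD; [exact: measurable_cst|exact: measurable_funeM].
have c0 : (0 <= (5 * d) `^ al * k4)%R by rewrite mulr_ge0.
rewrite (ball_avgD (phi := cst (ball_max y)))//; last 2 first.
- by move=> z; rewrite mule_ge0 ?lee_fin.
- exact: measurable_funeM.
rewrite ball_avg_cst// leeD2l// ball_avgZ// [in leRHS]EFinM -muleA lee_wpmul2l ?lee_fin//.
exact: ball_avg_le_max_avg.
Qed.

(** Large radii: the ball around [x] is compared with the smaller ball of radius
    [r - 2 d] around [y], the point [x + z] being matched with [y + rho z].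
    Averages over balls of radius [d] about the points [y + rho z] are inserted,
    because the two points of a pair are not translates of each other. *)
Let estimate_large x y r (d := enorm (x - y)) : G x -> G y -> (0 < d)%R ->
  (r < delta x)%R -> (3 * d < r)%R ->
  ball_avg r (fun z => (g (x + z)%R)%:E) <=
    ball_max y + ((4 * d) `^ al * k12 * k4)%:E *
      (max_diag (max_fst F) (x, y) + max_diag (max_snd F) (x, y)).
Proof.
move=> Gx Gy d0 rx r3d.
have r0 : (0 < r)%R by lra.
(* As [delta] is 1-Lipschitz, [r' + d < delta y]: the balls of radius [d] about
   the points [y + rho z] stay in [G]. *)
pose r' := (r - 2 * d)%R; pose rho := (r' / r)%R.
have r'0 : (0 < r')%R by rewrite /r'; lra.
have rho0 : (0 < rho)%R by rewrite divr_gt0.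
have rhor : (rho * r = r')%R by rewrite divfK// gt_eqF.
have rho1 : (0 <= 1 - rho)%R by rewrite subr_ge0 ler_pdivrMr// mul1r /r'; lra.
have dxy := delta_lip x y.
have yr' : (r' + d < delta y)%R by rewrite /r'; rewrite -/d in dxy; lra.
have D0 : (0 <= (4 * d) `^ al)%R by exact: powR_ge0.
have My0 : 0 <= ball_max y.
  by apply: le_trans (ball_avg_le_ball_max r'0 _); [exact: ball_avg_ge0|lra].
have mdil : measurable_fun [set: X] (fun z : X => (rho *: (z : V))%R : X).
  exact: measurable_scale_rV.
have mdtr a : measurable_fun [set: X] (fun z : X => (a + rho *: (z : V))%R : X).
  exact: measurable_addrV.
have mf := measurable_max_fst mF F0; have ms := measurable_max_snd mF F0.
have f0 := max_fst_ge0 F0; have s0 := max_snd_ge0 F0.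
have step z : (enorm z < r)%R ->
    (g (x + z)%R)%:E <= (g (y + rho *: z)%R)%:E +
      ((4 * d) `^ al * k12)%:E *
        (max_fst F (x + rho *: z, y + rho *: z)%R + max_snd F (x + z, y + z)%R).
  move=> zr.
  have rzr : (enorm (rho *: z) < r')%R by rewrite enormZ ?(ltW rho0)// -rhor ltr_pM2l.
  have Gxz : G (x + z)%R.
    by apply: (eball_delta Gx); rewrite /eball/= opprD addrA subrr sub0r enormN (lt_trans zr).
  have rz : ((1 - rho) * enorm z <= 2 * d)%R.
    rewrite (@le_trans _ _ ((1 - rho) * r)%R) ?ler_wpM2l ?(ltW zr)//.
    by rewrite mulrBl rhor mul1r /r'; lra.
  have Gyz : G (y + rho *: z)%R.
    apply: (eball_delta Gy); rewrite /eball/= opprD addrA subrr sub0r enormN.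
    by apply: (lt_trans rzr); lra.
  pose F1 w := F (y + rho *: z + w, y + rho *: z)%R.
  pose F2 w := F (x + z, y + rho *: z + w)%R.
  have mF1 : measurable_fun [set: X] F1 by exact: (mpair mF (mtr (y + rho *: z)%R) (mcst (y + rho *: z)%R)).
  have mF2 : measurable_fun [set: X] F2 by exact: (mpair mF (mcst (x + z)%R) (mtr (y + rho *: z)%R)).
  have mF12 : measurable_fun [set: X] (F1 \+ F2) := emeasurable_funD mF1 mF2.
  have F10 w : 0 <= F1 w by exact: F0.
  have F20 w : 0 <= F2 w by exact: F0.
  rewrite -[leLHS](@ball_avg_cst R n _ _ d0)//.
  apply: (@le_trans _ _ (ball_avg d (fun w => (g (y + rho *: z)%R)%:E +
     ((4 * d) `^ al)%:E * (F1 w + F2 w)))).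
    apply: ball_avg_le => //.
    - by move=> w; exact: g0'.
    - apply: emeasurable_funD; first exact: measurable_cst.
      by apply: measurable_funeM; exact: mF12.
    move=> w wd.
    have Gyzw : G (y + rho *: z + w)%R.
      apply: (eball_delta Gy); rewrite /eball/= -addrA opprD addrA subrr sub0r enormN.
      by rewrite (le_lt_trans (enormD _ _))//; lra.
    (* From [x + z] to the auxiliary point [y + rho z + w], then to [y + rho z]. *)
    apply: (@le_trans _ _ ((g (y + rho *: z + w)%R)%:E + ((4 * d) `^ al)%:E * F2 w)).
      apply: le_F => //.
      have -> : (x + z - (y + rho *: z + w) = (x - y) + ((1 - rho) *: z - w))%R.
        by rewrite scalerBl scale1r !opprD; apply/rowP => i; rewrite !mxE; ring.
      rewrite (le_trans (enormD _ _))// -/d.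
      have := enormD ((1 - rho) *: z) (- w); rewrite enormN enormZ//.
      lra.
    rewrite ge0_muleDr// addeA leeD2r//; apply: le_F => //.
    by rewrite addrAC subrr add0r; lra.
  rewrite (ball_avgD (phi := cst (g (y + rho *: z)%R)%:E))//; last 3 first.
  - by move=> w; exact: g0'.
  - by move=> w; rewrite mule_ge0// adde_ge0.
  - by apply: measurable_funeM; exact: mF12.
  rewrite ball_avg_cst// leeD2l// ball_avgZ//; last by move=> w; rewrite adde_ge0.
  rewrite EFinM -muleA lee_wpmul2l ?lee_fin// ball_avgD// ge0_muleDr//.
  have k12E : ((4 * (3 * d) / d) ^+ n / v = k12)%R.
    by rewrite /k12 mulrA mulfK ?gt_eqF//; congr (_ ^+ _ / _)%R; ring.
  apply: leeD.
    rewrite -k12E (_ : F1 = fun w => F (x + rho *: z + (y - x + w), y + rho *: z)%R); last first.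
      apply/funext => w; rewrite /F1; congr (F (_, _)).
      by apply/rowP => i; rewrite !mxE; ring.
    apply: (ball_avg_translate_le_max_avg (phi := fun w => F (x + rho *: z + w, y + rho *: z)%R)) => //.
      by rewrite enormB -/d; lra.
    exact: (mpair mF (mtr (x + rho *: z)%R) (mcst (y + rho *: z)%R)).
  rewrite -k12E (_ : F2 = fun w => F (x + z, y + z + (rho *: z - z + w))%R); last first.
    apply/funext => w; rewrite /F2; congr (F (_, _)).
    by apply/rowP => i; rewrite !mxE; ring.
  apply: (ball_avg_translate_le_max_avg (phi := fun w => F (x + z, y + z + w)%R)) => //.
    rewrite -[(rho *: z - z)%R]opprB -{1}(scale1r z) -scalerBl enormN enormZ//.
    lra.
  exact: (mpair mF (mcst (x + z)%R) (mtr (y + z)%R)).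
have c0 : (0 <= (4 * d) `^ al * k12)%R by rewrite mulr_ge0.
have m1 : measurable_fun [set: X] (fun z => (g (y + rho *: (z : V))%R)%:E).
  exact: (measurableT_comp mg' (mdtr y)).
have m2 : measurable_fun [set: X] (fun z => max_fst F (x + rho *: (z : V), y + rho *: (z : V))%R).
  exact: (mpair mf (mdtr x) (mdtr y)).
have m3 : measurable_fun [set: X] (fun z => max_snd F (x + z, y + z)%R).
  exact: (mpair ms (mtr x) (mtr y)).
have m23 := emeasurable_funD m2 m3.
apply: (@le_trans _ _ (ball_avg r (fun z => (g (y + rho *: z)%R)%:E +
      ((4 * d) `^ al * k12)%:E *
        (max_fst F (x + rho *: z, y + rho *: z)%R + max_snd F (x + z, y + z)%R)))).
  apply: ball_avg_le => [//|z|||z zr]; [exact: g0'|exact: mg_tr| |exact: step].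
  by apply: (emeasurable_funD m1); apply: measurable_funeM; exact: m23.
rewrite ball_avgD//; last 2 first.
- by move=> z; rewrite mule_ge0 ?lee_fin// adde_ge0.
- by apply: measurable_funeM; exact: m23.
rewrite (ball_avg_dilate (phi := fun z => (g (y + z)%R)%:E))// rhor.
apply: leeD; first by apply: ball_avg_le_ball_max => //; lra.
rewrite ball_avgZ//; last by move=> z; rewrite adde_ge0.
rewrite [in leRHS]EFinM -muleA lee_wpmul2l ?lee_fin// ball_avgD// ge0_muleDr ?max_diag_ge0//.
apply: leeD; last exact: (ball_avg_le_max_avg (phi := fun z => max_snd F (x + z, y + z)%R)).
rewrite (ball_avg_dilate (phi := fun z => max_fst F (x + z, y + z)%R))// ?rhor.
  by apply: ball_avg_le_max_avg => //; exact: (mpair mf (mtr x) (mtr y)).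
exact: (mpair mf (mtr x) (mtr y)).
Qed.

(** The first term serves the small radii, the other two the large ones. *)
Definition quotient_max (w : V * V) : \bar R :=
  max_fst (max_snd F) w + (max_diag (max_fst F) w + max_diag (max_snd F) w).

Lemma quotient_max_ge0 w : 0 <= quotient_max w.
Proof.
by rewrite !adde_ge0 ?max_fst_ge0 ?max_diag_ge0// => ?; rewrite ?max_fst_ge0 ?max_snd_ge0.
Qed.

(** The distances that occur are at most [5 d], and two averages are replaced by
    maximal averages. *)
Definition pointwise_cst : R := (5 `^ al * k12 * k12)%R.

Lemma ball_max_le x y : G x -> G y -> x != y ->
  ball_max x <= ball_max y + (pointwise_cst * enorm (x - y) `^ al)%:E * quotient_max (x, y).
Proof.
move=> Gx Gy xy; set d := enorm (x - y).
have d0 : (0 < d)%R by exact: enorm_gt0.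
have k412 : (k4 <= k12)%R.
  rewrite /k4 /k12 ler_pM2r ?invr_gt0 ?ball_volume_gt0//.
  by apply: lerXn2r; rewrite ?nnegrE// ler_nat.
apply: ge_ereal_sup => _ [r /= /[!in_itv]/= /andP[r0 rx] <-].
have fs0 : 0 <= max_fst (max_snd F) (x, y) by apply: max_fst_ge0 => ?; exact: max_snd_ge0.
have df0 : 0 <= max_diag (max_fst F) (x, y) by apply: max_diag_ge0 => ?; exact: max_fst_ge0.
have ds0 : 0 <= max_diag (max_snd F) (x, y) by apply: max_diag_ge0 => ?; exact: max_snd_ge0.
have pow5 : ((5 * d) `^ al = 5 `^ al * d `^ al)%R by rewrite powRM// ltW.
have pow45 : ((4 * d) `^ al <= (5 * d) `^ al)%R.
  apply: ge0_ler_powR; rewrite ?nnegrE ?(ltW al0) ?mulr_ge0 ?(ltW d0)//.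
  by rewrite ler_pM2r// ler_nat.
have P5 : (0 <= 5 `^ al :> R)%R by exact: powR_ge0.
have Pd : (0 <= d `^ al)%R by exact: powR_ge0.
have cst_ge0 (D q1 q2 : R) : (0 <= q1)%R -> (0 <= q2)%R -> 0 <= (D `^ al * q1 * q2)%:E.
  by move=> q10 q20; rewrite lee_fin mulr_ge0 ?mulr_ge0// powR_ge0.
have cst_le (q1 q2 : R) : (0 <= q1 <= k12)%R -> (0 <= q2 <= k12)%R ->
    ((5 * d) `^ al * q1 * q2)%:E <= (pointwise_cst * d `^ al)%:E.
  move=> /andP[q10 q1k] /andP[q20 q2k]; rewrite lee_fin pow5 /pointwise_cst.
  rewrite (_ : _ * q1 * q2 = (5 `^ al * d `^ al) * (q1 * q2))%R; last by ring.
  rewrite (_ : _ * k12 * k12 * _ = (5 `^ al * d `^ al) * (k12 * k12))%R; last by ring.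
  by rewrite ler_wpM2l ?mulr_ge0// ler_pM.
have k4k : (0 <= k4 <= k12)%R by rewrite k4_ge0 k412.
have kk : (0 <= k12 <= k12)%R by rewrite k12_ge0 lexx.
have [r3d|r3d] := leP r (3 * d)%R.
  apply: le_trans (estimate_small Gx Gy d0 r0 rx r3d) _; rewrite leeD2l//.
  apply: lee_pmul (cst_ge0 _ _ _ k4_ge0 k4_ge0) fs0 (cst_le _ _ k4k k4k) _.
  by rewrite /quotient_max; exact: (leeDl _ (adde_ge0 df0 ds0)).
apply: le_trans (estimate_large Gx Gy d0 rx r3d) _; rewrite leeD2l//.
apply: lee_pmul (cst_ge0 _ _ _ k12_ge0 k4_ge0) (adde_ge0 df0 ds0) _ _.
  apply: le_trans (cst_le _ _ kk k4k); rewrite lee_fin -/d.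
  by rewrite ler_wpM2r// ler_wpM2r.
by rewrite /quotient_max; exact: (leeDr _ fs0).
Qed.

End pointwise_estimate.

(** * Distance to the boundary and difference quotients *)

Section distance_to_the_boundary.
Context {R : realType} {n : nat}.
Local Notation V := 'rV[R]_n.
Variable G : set V.
Hypothesis oG : open G.

Let openG x : G x -> exists2 e, 0 < e & forall y : V, enorm (x - y) < e -> G y.
Proof.
move=> Gx; have /nbhs_rVP[e e0 xG] : nbhs x G by apply: open_nbhs_nbhs; split.
exists e => // y xy; apply: xG => i; apply: le_lt_trans xy.
by have := coord_le_enorm (x - y) i; rewrite !mxE.
Qed.

Let boundaryE b : boundary G b <-> ~ G b /\ closure G b.
Proof. by rewrite /boundary (interior_id G).1//; split=> -[]. Qed.

(** The witness is the last point up to which the segment from [x] to [y] stays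
    in [G]. *)
Lemma boundary_crossing x y : G x -> ~ G y ->
  exists2 b, boundary G b & enorm (x - b) <= enorm (x - y).
Proof.
move=> Gx nGy; pose gam t : V := x + t *: (y - x).
have gamB s t : enorm (gam s - gam t) = `|s - t| * enorm (x - y).
  rewrite /gam opprD addrACA subrr add0r -scalerBl.
  have [st|st] := leP 0 (s - t).
    by rewrite enormZ// ger0_norm// enormB.
  by rewrite -enormN -scaleNr enormZ ?oppr_ge0 ?(ltW st)// ltr0_norm// enormB.
pose T := [set t | 0 <= t <= 1 /\ forall u, 0 <= u <= t -> G (gam u)].
have gam0 : gam 0 = x by rewrite /gam scale0r addr0.
have gam1 : gam 1 = y by rewrite /gam scale1r addrC subrK.
have T0 : T 0.
  split; first by rewrite lexx ler01.
  by move=> u /andP[u0 u0']; rewrite (_ : u = 0) ?gam0//; apply/eqP; rewrite eq_le u0 u0'.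
have supT : has_sup T by split; [exists 0|exists 1 => t [/andP[_ ?]]].
pose t0 := sup T.
have t0ge t : T t -> t <= t0 by move=> Tt; apply: ub_le_sup => //; case: supT.
have t0_ge0 : 0 <= t0 by exact: t0ge.
have t0_le1 : t0 <= 1 by apply: ge_sup; [exists 0|move=> t [/andP[_ ?]]].
have small e : 0 < e -> exists2 eta, 0 < eta &
    forall t, `|t0 - t| < eta -> enorm (gam t0 - gam t) < e.
  move=> e0; have L0 : 0 < enorm (x - y) + 1 by rewrite ltr_wpDl ?enorm_ge0.
  exists (e / (enorm (x - y) + 1)); first by rewrite divr_gt0.
  move=> t; rewrite ltr_pdivlMr// gamB; apply: le_lt_trans.
  by rewrite ler_wpM2l// lerDl.
exists (gam t0); last first.
  by rewrite -[x in x - _]gam0 gamB sub0r normrN ger0_norm// ler_piMl ?enorm_ge0.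
apply/boundaryE; split.
  move=> /openG[e e0 eG]; have [eta eta0 etaG] := small _ e0.
  have inG u : 0 <= u <= t0 + eta / 2 -> G (gam u).
    move=> /andP[u0 u1]; have [ut|tu] := ltP u t0.
      have t0u : 0 < t0 - u by rewrite subr_gt0.
      have [t Tt] := sup_adherent t0u supT.
      rewrite -/t0 opprB addrC subrK => ut'; apply: Tt.2.
      by rewrite u0 ltW.
    apply/eG/etaG; rewrite ler0_norm ?subr_le0// opprB.
    by move: u1 eta0; lra.
  have [t1|t1] := leP (t0 + eta / 2) 1; last first.
    by apply: nGy; rewrite -gam1; apply: inG; rewrite ler01 ltW.
  have /t0ge : T (t0 + eta / 2).
    by split => //; rewrite t1 addr_ge0// divr_ge0// ltW.
  by rewrite gerDl leNgt divr_gt0.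
rewrite closureEnbhs/= => A B GA /nbhs_rVP[e e0 eB].
have [eta eta0 etaB] := small _ e0.
have [t Tt t0t] := sup_adherent eta0 supT; exists (gam t); split.
  by apply: GA; apply: Tt.2; rewrite lexx andbT; case: Tt => /andP[].
apply: eB => i; apply: le_lt_trans (etaB t _).
  by have := coord_le_enorm (gam t0 - gam t) i; rewrite !mxE.
by rewrite ger0_norm ?subr_ge0 ?t0ge//; move: t0t; rewrite -/t0; lra.
Qed.

Hypothesis G_neq0 : G !=set0.
Hypothesis G_neqT : G `<` setT.

Lemma boundary_neq0 : boundary G !=set0.
Proof.
have [x Gx] := G_neq0; have [_ /nonsubset [y [_ nGy]]] := G_neqT.
by have [b bb _] := boundary_crossing Gx nGy; exists b.
Qed.

Local Notation delta x := (dist_to x (boundary G)).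

Let dist_has_lbound x : has_lbound [set enorm (x - y) | y in boundary G].
Proof. by exists 0 => _ [b _ <-]; exact: enorm_ge0. Qed.

Let dist_neq0 x : [set enorm (x - y) | y in boundary G] !=set0.
Proof. by have [b bb] := boundary_neq0; exists (enorm (x - b)), b. Qed.

Lemma dist_to_boundary_lip x y : delta x <= delta y + enorm (x - y).
Proof.
rewrite -lerBlDr; apply: lb_le_inf => // _ [b bb <-].
rewrite lerBlDr addrC (le_trans _ (enorm_triangle y _ _))//.
by apply: ge_inf => //; exists b.
Qed.

Lemma dist_to_boundary_gt0 x : G x -> 0 < delta x.
Proof.
move=> /openG[e e0 eG]; apply: (lt_le_trans e0); apply: lb_le_inf => // _ [b bb <-].
have [nGb _] := (boundaryE b).1 bb.
by rewrite leNgt; apply/negP => /eG.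
Qed.

Lemma eball_dist_to_boundary x : G x -> eball x (delta x) `<=` G.
Proof.
move=> Gx y; rewrite /eball/= => xy; apply: contrapT => nGy.
have [b bb xb] := boundary_crossing Gx nGy.
move: xy; rewrite ltNge => /negP; apply; apply: le_trans xb.
by apply: ge_inf => //; exists b.
Qed.

End distance_to_the_boundary.

Section difference_quotient.
Context {R : realType} {n : nat}.
Local Notation Rm := (measurableTypeR R).
Local Notation X := 'rV[Rm]_n.
Local Notation V := 'rV[R]_n.
Variables (G : set V) (g : V -> R) (al : R).
Hypothesis mG : measurable (G : set X).
Hypothesis mg : measurable_fun [set: X] g.
Hypothesis al0 : 0 < al.
Local Open Scope ereal_scope.

(** On the diagonal the value is 0, by the convention on division by zero. *)
Definition quotient (w : V * V) : \bar R :=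
  ((\1_(G `*` G) w * `|g w.1 - g w.2|) / enorm (w.1 - w.2) `^ al)%:E.

Lemma quotient_ge0 w : 0 <= quotient w.
Proof. by rewrite lee_fin divr_ge0 ?powR_ge0// mulr_ge0. Qed.

Lemma measurable_quotient : measurable_fun [set: X * X] quotient.
Proof.
apply/measurable_EFinP; apply: measurable_funM.
  apply: measurable_funM.
    by apply: measurable_indic; exact: measurableX.
  apply: (measurableT_comp (@normr_measurable R setT)); apply: measurable_funB.
    exact: (measurableT_comp mg measurable_fst).
  exact: (measurableT_comp mg measurable_snd).
under eq_fun do rewrite -powRN.
apply: (measurableT_comp (measurable_powR (- al))).
apply: measurable_enorm.
exact: (measurable_subV measurable_fst measurable_snd).
Qed.

Lemma le_quotient a b (D : R) : G a -> G b -> (enorm (a - b) <= D)%R ->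
  (g a)%:E <= (g b)%:E + (D `^ al)%:E * quotient (a, b).
Proof.
move=> Ga Gb abD; rewrite /quotient/= indicE mem_set//= mul1r -EFinM -EFinD lee_fin.
rewrite -lerBlDl (le_trans (ler_norm _))//.
have [->|ab] := eqVneq a b.
  by rewrite subrr normr0 mul0r mulr0.
have e0 : (0 < enorm (a - b) `^ al)%R by rewrite powR_gt0// enorm_gt0.
rewrite mulrCA ler_peMr// ler_pdivlMr// mul1r.
by apply: ge0_ler_powR; rewrite ?nnegrE ?(ltW al0) ?enorm_ge0// (le_trans _ abD)// enorm_ge0.
Qed.


End difference_quotient.

(** * Energies and measurability of maximal functions *)

Section energy_of_the_maximal_function.
Context {R : realType} {n : nat}.
Local Notation Rm := (measurableTypeR R).
Local Notation X := 'rV[Rm]_n.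
Local Notation V := 'rV[R]_n.
Local Notation mu := (@borel_lebesgue R n).
Local Open Scope ereal_scope.

Definition energy (p : R) (H : V * V -> \bar R) : \bar R :=
  \int[mu]_x \int[mu]_y (H (x, y) `^ p).

Lemma energy_ge0 p H : 0 <= energy p H.
Proof. by apply: integral_ge0 => x _; apply: integral_ge0 => y _; exact: poweR_ge0. Qed.

Lemma le_integral2 (H1 H2 : V * V -> \bar R) :
  measurable_fun [set: X * X] H1 -> measurable_fun [set: X * X] H2 ->
  (forall w, 0 <= H1 w) -> (forall w, H1 w <= H2 w) ->
  \int[mu]_x \int[mu]_y H1 (x, y) <= \int[mu]_x \int[mu]_y H2 (x, y).
Proof.
move=> m1 m2 H10 H12.
have H20 w : 0 <= H2 w by exact: le_trans (H12 w).
apply: ge0_le_integral => //.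
- by move=> x _; apply: integral_ge0.
- exact: measurable_integral_snd.
- exact: measurable_integral_snd.
move=> x _; apply: ge0_le_integral => //.
- by apply: (measurableT_comp m1); exact: measurable_pair1.
- by apply: (measurableT_comp m2); exact: measurable_pair1.
Qed.

Lemma integral2D (H1 H2 : V * V -> \bar R) :
  measurable_fun [set: X * X] H1 -> measurable_fun [set: X * X] H2 ->
  (forall w, 0 <= H1 w) -> (forall w, 0 <= H2 w) ->
  \int[mu]_x \int[mu]_y (H1 (x, y) + H2 (x, y)) =
    \int[mu]_x \int[mu]_y H1 (x, y) + \int[mu]_x \int[mu]_y H2 (x, y).
Proof.
move=> m1 m2 H10 H20; rewrite -ge0_integralD//; last 4 first.
- by move=> x _; exact: integral_ge0.
- exact: measurable_integral_snd.
- by move=> x _; exact: integral_ge0.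
- exact: measurable_integral_snd.
apply: eq_integral => x _; rewrite ge0_integralD//.
- by apply: (measurableT_comp m1); exact: measurable_pair1.
- by apply: (measurableT_comp m2); exact: measurable_pair1.
Qed.

Lemma integral2Z (k : R) (H : V * V -> \bar R) : (0 <= k)%R ->
  measurable_fun [set: X * X] H -> (forall w, 0 <= H w) ->
  \int[mu]_x \int[mu]_y (k%:E * H (x, y)) = k%:E * \int[mu]_x \int[mu]_y H (x, y).
Proof.
move=> k0 mH H0; rewrite -ge0_integralZl ?lee_fin//; last 2 first.
- exact: measurable_integral_snd.
- by move=> x _; exact: integral_ge0.
apply: eq_integral => x _; rewrite ge0_integralZl ?lee_fin//.
by apply: (measurableT_comp mH); exact: measurable_pair1.
Qed.

Lemma energyD_le p (H1 H2 : V * V -> \bar R) : (0 <= p)%R ->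
  measurable_fun [set: X * X] H1 -> measurable_fun [set: X * X] H2 ->
  (forall w, 0 <= H1 w) -> (forall w, 0 <= H2 w) ->
  energy p (fun w => H1 w + H2 w) <= (2 `^ p)%:E * (energy p H1 + energy p H2).
Proof.
move=> p0 m1 m2 H10 H20.
have mp1 := measurable_poweR_comp p m1; have mp2 := measurable_poweR_comp p m2.
have mp12 := emeasurable_funD mp1 mp2.
rewrite /energy -(integral2D mp1 mp2 (fun w => poweR_ge0 _ _) (fun w => poweR_ge0 _ _)).
rewrite -(integral2Z (powR_ge0 _ _) mp12 (fun w => adde_ge0 (poweR_ge0 _ _) (poweR_ge0 _ _))).
apply: (le_integral2 (H1 := fun w => (H1 w + H2 w) `^ p)
                     (H2 := fun w => (2 `^ p)%:E * (H1 w `^ p + H2 w `^ p))).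
- by apply: measurable_poweR_comp; exact: emeasurable_funD.
- exact: measurable_funeM.
- by move=> w; exact: poweR_ge0.
- by move=> w; exact: poweRD_le.
Qed.

Lemma measurable_quotient_max (F : V * V -> \bar R) : measurable_fun [set: X * X] F ->
  (forall w, 0 <= F w) -> measurable_fun [set: X * X] (quotient_max F).
Proof.
move=> mF F0.
have mf := measurable_max_fst mF F0; have ms := measurable_max_snd mF F0.
have f0 := max_fst_ge0 F0; have s0 := max_snd_ge0 F0.
exact: (emeasurable_funD (measurable_max_fst ms s0)
  (emeasurable_funD (measurable_max_diag mf f0) (measurable_max_diag ms s0))).
Qed.

(** Each term is a composition of two maximal operators bounded on [L^p]. *)
Lemma quotient_max_bound (p : R) : (1 < p)%R -> exists2 C : R, (0 < C)%R &
  forall F : V * V -> \bar R, measurable_fun [set: X * X] F -> (forall w, 0 <= F w) ->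
    energy p (quotient_max F) <= C%:E * energy p F.
Proof.
move=> p1; have p0 : (0 <= p)%R by exact/ltW/(lt_trans _ p1).
have [C C0 strong] := @max_fun_strong_type R n p p1.
pose P : R := (2 `^ p)%R.
have P0 : (0 < P)%R by exact: powR_gt0.
exists (P * (C * C + P * (C * C + C * C)))%R.
  by rewrite !(mulr_gt0, addr_gt0).
move=> F mF F0.
have mf := measurable_max_fst mF F0; have ms := measurable_max_snd mF F0.
have f0 := max_fst_ge0 F0; have s0 := max_snd_ge0 F0.
have mfs := measurable_max_fst ms s0; have fs0 := max_fst_ge0 s0.
have mdf := measurable_max_diag mf f0; have df0 := max_diag_ge0 f0.
have mds := measurable_max_diag ms s0; have ds0 := max_diag_ge0 s0.
have mdd := emeasurable_funD mdf mds.
have dd0 w : 0 <= max_diag (max_fst F) w + max_diag (max_snd F) w.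
  exact: adde_ge0 (df0 w) (ds0 w).
have bs := max_snd_bound C0 strong mF F0.
have bf := max_fst_bound C0 strong mF F0.
have bfs := max_fst_bound C0 strong ms s0.
have bdf := max_diag_bound C0 strong mf f0.
have bds := max_diag_bound C0 strong ms s0.
have Cge0 : 0 <= C%:E by rewrite lee_fin ltW.
have two A B D : A <= C%:E * B -> B <= C%:E * D -> A <= (C * C)%:E * D.
  by move=> AB BD; rewrite EFinM -muleA (le_trans AB)// lee_wpmul2l.
have E0 := energy_ge0 p F.
apply: (le_trans (energyD_le p0 mfs mdd fs0 dd0)).
rewrite EFinM -muleA; apply: lee_wpmul2l; first by rewrite lee_fin ltW.
have CC : (0 <= C * C)%R by rewrite mulr_ge0// ltW.
rewrite EFinD ge0_muleDl ?lee_fin ?mulr_ge0 ?addr_ge0 ?(ltW P0)//.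
apply: leeD; first exact: two bfs bs.
apply: (le_trans (energyD_le p0 mdf mds df0 ds0)).
rewrite EFinM -muleA; apply: lee_wpmul2l; first by rewrite lee_fin ltW.
rewrite EFinD ge0_muleDl ?lee_fin//.
by apply: leeD; [exact: two bdf bf|exact: two bds bs].
Qed.

End energy_of_the_maximal_function.

Section maximal_function_of_a_borel_function.
Context {R : realType} {n : nat}.
Local Notation Rm := (measurableTypeR R).
Local Notation X := 'rV[Rm]_n.
Local Notation V := 'rV[R]_n.
Local Notation mu := (@borel_lebesgue R n).
Variables (G : set V) (delta : V -> R).
Hypothesis delta_gt0 : forall x, G x -> 0 < delta x.
Hypothesis delta_lip : forall x y, delta x <= delta y + enorm (x - y).
Hypothesis eball_delta : forall x, G x -> eball x (delta x) `<=` G.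
Hypothesis mG : measurable (G : set X).
Variable g : V -> R.
Hypothesis g0 : forall x, 0 <= g x.
Hypothesis mg : measurable_fun [set: X] g.

Local Open Scope ereal_scope.

Let mg' : measurable_fun [set: X] (fun z => (g z)%:E).
Proof. exact/measurable_EFinP. Qed.

Let g0' z : 0 <= (g z)%:E. Proof. by rewrite lee_fin. Qed.

Let mg_tr x : measurable_fun [set: X] (fun z => (g (x + z)%R)%:E).
Proof. exact: (measurable_fun_translate x mg'). Qed.

Lemma ball_max_ge0 x : G x -> 0 <= ball_max delta g x.
Proof.
move=> Gx; have d0 := delta_gt0 Gx.
apply: (@le_trans _ _ (ball_avg (delta x / 2) (fun z => (g (x + z)%R)%:E))).
  by apply: ball_avg_ge0; rewrite ?divr_gt0.
apply: ereal_sup_ubound; exists (delta x / 2)%R => //=.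
by rewrite in_itv/= divr_gt0// ltr_pdivrMr// ltr_pMr// ltr1n.
Qed.

Lemma ball_max_le_max_fun x :
  ball_max delta g x <= (4 ^+ n / ball_volume R n)%:E * max_fun (fun z => (g z)%:E) x.
Proof.
apply: ge_ereal_sup => _ [r /= /[!in_itv]/= /andP[r0 rx] <-].
exact: (ball_avg_le_max_avg r0 (fun z => g0' _) (mg_tr x)).
Qed.

Let measurable_delta_gt (r : R) : measurable ([set x | (r < delta x)%R] : set X).
Proof.
apply: open_measurable_rV; rewrite openE => x /= rx; apply/nbhs_rVP.
pose e := ((delta x - r) / n.+1%:R)%R.
have e0 : (0 < e)%R by rewrite divr_gt0// subr_gt0.
exists e => // y xy.
have : (enorm (x - y) < n.+1%:R * e)%R by apply: enorm_lt => // i; have := xy i; rewrite !mxE.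
rewrite mulrC divfK ?pnatr_eq0// => xy'.
by have := delta_lip x y; move: xy'; rewrite /=; lra.
Qed.

(** As radii increase to [r], the balls exhaust the open ball of radius [r]
    while the normalizing factors decrease to its own; hence rational radii
    suffice in the supremum that defines [ball_max]. *)
Let ball_avg_gt_rational x r (a : R) : (0 < r)%R ->
  a%:E < ball_avg r (fun z => (g (x + z)%R)%:E) ->
  exists2 j, (radius_seq j < r :> R)%R & a%:E < ball_avg (radius_seq j) (fun z => (g (x + z)%R)%:E).
Proof.
move=> r0 ar; pose phi z := (g (x + z)%R)%:E.
have phi0 z : 0 <= phi z by exact: g0'.
have mphi : measurable_fun [set: X] phi by exact: mg_tr.
pose rk k : R := (r * (1 - k.+2%:R^-1))%R.
have rk_gt0 k : (0 < rk k)%R by rewrite mulr_gt0// subr_gt0 invf_lt1// ltr1n.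
have rk_lt k : (rk k < r)%R by rewrite gtr_pMr// gtrBl invr_gt0.
pose B k : set X := eball (0%R : V) (rk k).
have mB k : measurable (B k) by exact: measurable_eball.
have UB : \bigcup_k B k = (eball (0%R : V) r : set X).
  apply/seteqP; split => z; first by move=> [k _ /lt_trans]; apply.
  rewrite /eball/= => zr.
  have rz0 : (0 < (r - enorm (0 - z)) / r)%R by rewrite divr_gt0// subr_gt0.
  have [k _ /(_ k.+1 (leqnSn k)) /= ke] := near_infty_natSinv_lt (PosNum rz0).
  exists k => //; rewrite /B /eball/= /rk mulrBr mulr1 ltrBrDl -ltrBrDr mulrC -ltr_pdivlMr//.
have ndB : {homo B : k m / (k <= m)%N >-> (k <= m)%O}.
  move=> k m km; apply/subsetPset => z; rewrite /B /eball/= => zk.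
  apply: lt_le_trans zk _; rewrite ler_pM2l// lerD2l lerN2 lef_pV2 ?posrE//.
  by rewrite ler_nat.
have cv : \int[mu]_(z in B k) phi z @[k --> \oo] --> \int[mu]_(z in eball (0%R : V) r) phi z.
  rewrite -UB; apply: ge0_nondecreasing_set_cvg_integral => // i.
  exact: measurable_funTS.
have c0 : (0 < (r ^+ n * ball_volume R n)^-1)%R.
  by rewrite invr_gt0 mulr_gt0 ?exprn_gt0// ball_volume_gt0.
have [k ak] : exists k, a%:E < ((r ^+ n * ball_volume R n)^-1)%:E * \int[mu]_(z in B k) phi z.
  apply: contrapT => /forallNP noa; move: ar; rewrite ltNge => /negP; apply.
  rewrite /ball_avg muleC -lee_pdivlMr//.
  rewrite -(cvg_lim _ cv)//; apply: lime_le; first by apply/cvg_ex; eexists; exact: cv.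
  apply: nearW => k; rewrite lee_pdivlMr// muleC.
  by have /negP := noa k; rewrite -leNgt.
have [j /andP[kj jr]] := radius_seq_dense (ltW (rk_gt0 k)) (rk_lt k).
exists j => //; have j0 := @radius_seq_gt0 R j.
apply: (lt_le_trans ak); apply: lee_pmul.
- by rewrite lee_fin ltW.
- by apply: integral_ge0.
- rewrite lee_fin lef_pV2 ?posrE ?mulr_gt0 ?exprn_gt0 ?ball_volume_gt0//.
  by rewrite ler_pM2r ?ball_volume_gt0// lerXn2r ?nnegrE ?ltW.
- apply: ge0_subset_integral => //; [exact: measurable_eball|exact: measurable_funTS|].
  by move=> z; rewrite /B /eball/= => zk; exact: lt_trans zk kj.
Qed.

Lemma measurable_ball_max : measurable_fun (G : set X) (ball_max delta g).
Proof.
apply: (measurability _ (ErealGenOInfty.measurableE R)) => _ [_ [a ->] <-].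
rewrite (_ : _ `&` _ = G `&` \bigcup_j ([set x | (radius_seq j < delta x)%R] `&`
   [set x | a%:E < ball_avg (radius_seq j) (fun z => (g (x + z)%R)%:E)])).
  apply: measurableI => //; apply: bigcup_measurable => j _; apply: measurableI.
    exact: measurable_delta_gt.
  rewrite -[Y in measurable Y]setTI; apply: emeasurable_fun_o_infty => //.
  apply: measurable_funeM.
  exact: (measurable_fun_integral_param (measurable_fun_add mg') (fun w => g0' _)
     (measurable_eball 0%R (radius_seq j))).
apply/seteqP; split => x [Gx]; rewrite /= ?in_itv/= ?andbT => ax; split => //.
  have [_ [r /= r_itv <-] ar] := ereal_sup_gt ax.
  move: r_itv; rewrite in_itv/= => /andP[r0 rx].
  have [j jr aj] := ball_avg_gt_rational r0 ar.
  by exists j => //; split => //=; exact: lt_trans rx.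
case: ax => j _ [/= jx aj]; apply: (lt_le_trans aj).
by apply: ereal_sup_ubound; exists (radius_seq j) => //=; rewrite in_itv/= radius_seq_gt0.
Qed.

End maximal_function_of_a_borel_function.

(** * Lebesgue measurable functions and Borel functions *)

Section lower_integral.
Context d (T : measurableType d) (R : realType) (m : {measure set T -> \bar R}).
Implicit Types (D N : set T) (f g h : T -> \bar R).
Local Open Scope ereal_scope.

(** The integral of a nonnegative function is a supremum over the simple
    functions below it, hence monotone without any measurability. *)
Lemma ge0_le_lower_integral f g : (forall x, 0 <= f x) -> (forall x, f x <= g x) ->
  \int[m]_x f x <= \int[m]_x g x.
Proof.
move=> f0 fg; rewrite !ge0_integralE//; last by move=> x _; exact: le_trans (fg x).
apply: le_ereal_sup => _ [h /= hf <-]; exists h => //= x.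
apply: le_trans (hf x) _; rewrite !patchE in_setT; exact: fg.
Qed.

(** The null set is absorbed by adding to [h] the function equal to [+oo] on it. *)
Lemma ge0_le_lower_integral_ae D N f h : measurable N -> m N = 0 ->
  measurable_fun [set: T] h -> (forall x, 0 <= h x) -> (forall x, D x -> 0 <= f x) ->
  (forall x, D x -> ~ N x -> f x <= h x) -> \int[m]_(x in D) f x <= \int[m]_x h x.
Proof.
move=> mN N0 mh h0 f0 fh.
have -> : \int[m]_x h x = \int[m]_x (h x + (cst +oo \_ N) x).
  have ooN0 x : 0 <= (cst (+oo : \bar R) \_ N) x.
    by rewrite patchE; case: ifPn => _; [exact: leey|exact: lexx].
  rewrite ge0_integralD//; last first.
    by apply/(measurable_restrictT _ _).1 => //; exact: measurable_cst.
  rewrite -(integral_mkcond N) integral_cst// N0 mule0 adde0//.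
rewrite integral_mkcond; apply: ge0_le_lower_integral => x.
  by rewrite patchE; case: ifPn => //; rewrite inE => /f0.
have hN : h x != -oo by rewrite -ltNye (lt_le_trans _ (h0 x)).
rewrite !patchE; case: ifPn => [|_]; last first.
  by case: ifPn => _; rewrite ?adde0//= addey// le0y.
rewrite inE => Dx; case: ifPn => [_|]; first by rewrite /= addey ?leey.
by rewrite notin_setE adde0; exact: fh.
Qed.

Lemma ge0_lower_integral_ge_ae D N f h : measurable N -> m N = 0 ->
  measurable_fun [set: T] h -> (forall x, 0 <= h x) -> (forall x, D x -> 0 <= f x) ->
  (forall x, ~ D x -> h x = 0) ->
  (forall x, D x -> ~ N x -> h x <= f x) -> \int[m]_x h x <= \int[m]_(x in D) f x.
Proof.
move=> mN N0 mh h0 f0 hD hf.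
rewrite (@ge0_negligible_integral _ _ _ _ _ N)// setTD.
rewrite integral_mkcond [leRHS]integral_mkcond; apply: ge0_le_lower_integral => x.
  by rewrite patchE; case: ifPn.
rewrite !patchE; case: ifPn => [|_]; last by case: ifPn => //; rewrite inE => /f0.
rewrite inE => Nx; case: ifPn; rewrite ?inE ?notin_setE => Dx; first exact: hf.
by rewrite hD.
Qed.

Lemma ge0_integral_lty_infinity_null h : measurable_fun [set: T] h -> (forall x, 0 <= h x) ->
  \int[m]_x h x < +oo -> m [set x | h x = +oo] = 0.
Proof.
move=> mh h0 hoo.
have ih : m.-integrable setT h.
  by apply/integrableP; split => //; under eq_integral do rewrite gee0_abs//.
have [N [mN N0 sN]] := integrable_ae measurableT ih.
apply/eqP; rewrite -measure_le0 -N0; apply: le_measure; rewrite ?inE//.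
  rewrite (_ : [set x | h x = +oo] = setT `&` h @^-1` [set +oo]) ?setTI//.
  by rewrite -[Y in measurable Y]setTI; apply: mh => //; exact: emeasurable_set1.
by move=> x /= hx; apply: sN => /(_ I); rewrite hx.
Qed.

End lower_integral.

Section lebesgue_and_borel.
Context {R : realType} {n : nat}.
Local Notation Rm := (measurableTypeR R).
Local Notation X := 'rV[Rm]_n.
Local Notation V := 'rV[R]_n.
Local Notation L := (lebesgue_space R n).
Local Notation mu := (@borel_lebesgue R n).
Local Notation nu := (lebesgue_rV R n).
Local Open Scope ereal_scope.

Lemma borel_lebesgue_measurable (A : set V) : measurable (A : set X) -> measurable (A : set L).
Proof. by move=> mA; exact: caratheodory_measurable_mu_ext. Qed.

Lemma lebesgue_rV_borel (A : set V) : measurable (A : set X) -> nu A = mu A.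
Proof. by move=> mA; exact: measurable_mu_extE. Qed.

Lemma borel_lebesgue_measurable_fun d (T : measurableType d) (D : set V) (h : V -> T) :
  measurable (D : set X) -> measurable_fun (D : set X) h -> measurable_fun (D : set L) h.
Proof. by move=> mD mh _ B mB; apply: borel_lebesgue_measurable; exact: mh. Qed.

Lemma integral_lebesgue_borel (h : V -> \bar R) : measurable_fun [set: X] h ->
  (forall x, 0 <= h x) -> \int[nu]_x h x = \int[mu]_x h x.
Proof.
move=> mh h0.
have mid : measurable_fun [set: L] (id : L -> X).
  by move=> _ B mB; rewrite setTI; exact: borel_lebesgue_measurable.
transitivity (\int[pushforward nu (id : L -> X)]_x h x).
  by rewrite ge0_integral_pushforward.
by apply: eq_measure_integral => A mA _; exact: lebesgue_rV_borel.
Qed.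

(** The envelope is the intersection of countable Borel covers whose measures
    tend to the outer measure. *)
Let borel_envelope_fin (A : set V) : (mu^*)%mu A < +oo ->
  exists2 B, measurable (B : set X) & A `<=` B /\ mu B <= (mu^*)%mu A.
Proof.
move=> Afin.
have A0 : 0 <= (mu^*)%mu A by apply: mu_ext_ge0.
have Afn : (mu^*)%mu A \is a fin_num by rewrite ge0_fin_numE.
have /choice[F AF] k : exists F : nat -> set X, [/\ forall i, measurable (F i),
    A `<=` \bigcup_i F i & mu (\bigcup_i F i) <= (mu^*)%mu A + (k.+1%:R^-1)%:E].
  have k0 : (0 < k.+1%:R^-1 :> R)%R by rewrite invr_gt0.
  have [_ [F [mF AF] <-] Fk] := lb_ereal_inf_adherent k0 Afn.
  exists F; split => //; apply: le_trans (ltW Fk).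
  by apply: measure_sigma_subadditive => //; exact: bigcup_measurable.
exists (\bigcap_k \bigcup_i F k i).
  apply: bigcap_measurable => // k _; apply: bigcup_measurable => i _.
  by have [mF _ _] := AF k.
split; first by move=> x Ax k _; have [_ + _] := AF k; exact.
apply/lee_addgt0Pr => e e0.
have [k _ /(_ k (leqnn k)) /= ke] := near_infty_natSinv_lt (PosNum e0).
have [mF _ Fk] := AF k.
apply: (@le_trans _ _ (mu (\bigcup_i F k i))).
  apply: le_measure; rewrite ?inE.
  - by apply: bigcap_measurable => // j _; apply: bigcup_measurable => i _; have [] := AF j.
  - exact: bigcup_measurable.
  - by move=> x; exact.
by apply: (le_trans Fk); rewrite leeD2l// lee_fin ltW.
Qed.

(** The finite case, applied to the pieces of [A] in sets of finite measure. *)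
Lemma borel_envelope (A : set V) : measurable (A : set L) ->
  exists2 B, measurable (B : set X) & A `<=` B /\ nu (B `\` A) = 0.
Proof.
move=> mA.
have [S [ST _ Soo]] := (sigma_finiteP _ _).1 (sigma_finiteT mu).
have mAS i : measurable (A `&` S i : set L).
  by apply: measurableI => //; apply: borel_lebesgue_measurable; case: (Soo i).
have ASoo i : (mu^*)%mu (A `&` S i) < +oo.
  have [mS Si] := Soo i.
  apply: (@le_lt_trans _ _ ((mu^*)%mu (S i))); first by apply: le_mu_ext => x [].
  by have -> : (mu^*)%mu (S i) = mu (S i) by exact: measurable_mu_extE.
have /choice[B AB] i : exists B : set X, [/\ measurable B, A `&` S i `<=` B &
    mu B <= (mu^*)%mu (A `&` S i)].
  by have [B mB [AB BA]] := borel_envelope_fin (ASoo i); exists B.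
have mB i : measurable (B i) by have [] := AB i.
exists (\bigcup_i B i); first exact: bigcup_measurable.
split.
  move=> x Ax; have [i _ Six] : (\bigcup_i S i) x by rewrite -ST.
  by exists i => //; have [_ + _] := AB i; apply.
have mD i : measurable (B i `\` (A `&` S i) : set L).
  by apply: measurableD => //; exact: borel_lebesgue_measurable.
have D0 i : nu (B i `\` (A `&` S i)) = 0.
  have [_ ABi BAi] := AB i.
  have BLi : measurable (B i : set L) by exact: borel_lebesgue_measurable.
  have BE : nu (B i) = nu (A `&` S i).
    apply/eqP; rewrite eq_le; apply/andP; split.
      by rewrite (lebesgue_rV_borel (mB i)).
    by apply: le_measure; rewrite ?inE.
  have ASfin : nu (A `&` S i) \is a fin_num.
    by rewrite ge0_fin_numE; [exact: ASoo|exact: mu_ext_ge0].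
  rewrite measureD//; last first.
    by apply: (le_lt_trans _ (ASoo i)); rewrite -[leLHS]/(nu (B i)) BE.
  rewrite (setIidr ABi).
  apply: (etrans (congr1 (fun z => z - nu (A `&` S i)) BE)).
  by rewrite subee.
have mDD : measurable ((\bigcup_i B i) `\` A : set L).
  by apply: measurableD => //; apply: bigcup_measurable => i _; exact: borel_lebesgue_measurable.
apply/eqP; rewrite -measure_le0.
apply: (@le_trans _ _ (\sum_(i <oo) nu (B i `\` (A `&` S i)))).
  apply: measure_sigma_subadditive => // x [[i _ Bx] nAx].
  by exists i => //; split => // -[].
by rewrite eseries0.
Qed.

(** A Lebesgue measurable function is almost everywhere equal to a Borel one:
    replace each superlevel set by a Borel envelope. *)
Lemma borel_representative (G : set V) (f : V -> \bar R) : measurable (G : set X) ->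
  measurable_fun (G : set L) f ->
  exists u : V -> \bar R, [/\ measurable_fun [set: X] u, forall x, 0 <= u x &
    exists N : set L, [/\ measurable N, nu N = 0 & forall x, G x -> ~ N x -> u x = `|f x|]].
Proof.
move=> mG mf.
have mGL : measurable (G : set L) by exact: borel_lebesgue_measurable.
pose A j : set L := G `&` [set x | (radius_seq j)%:E < `|f x|].
have mA j : measurable (A j).
  have mfa : measurable_fun (G : set L) (abse \o f) by exact: measurableT_comp.
  exact: (emeasurable_fun_o_infty mGL mfa).
have /choice[B AB] j : exists B : set X, [/\ measurable B, A j `<=` B & nu (B `\` A j) = 0].
  by have [B mB [AB BA]] := borel_envelope (mA j); exists B.
pose t j x : \bar R := (radius_seq j * \1_(B j) x)%:E.
have t0 j x : 0 <= t j x by rewrite lee_fin mulr_ge0// ltW// radius_seq_gt0.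
pose u x := ereal_sup (range (t^~ x)).
exists u; split.
- apply: (measurability _ (ErealGenOInfty.measurableE R)) => _ [_ [a ->] <-].
  rewrite setTI (_ : _ @^-1` _ = \bigcup_j [set x | a%:E < t j x]).
    apply: bigcup_measurable => j _; rewrite -[Y in measurable Y]setTI.
    apply: emeasurable_fun_o_infty => //; apply/measurable_EFinP.
    by apply: measurable_funM => //; apply: measurable_indic; have [] := AB j.
  apply/seteqP; split => x /=; rewrite in_itv/= andbT.
    by move=> /ereal_sup_gt[_ [j _ <-] ?]; exists j.
  by move=> [j _ aj]; apply: lt_le_trans aj _; apply: ereal_sup_ubound; exists j.
- by move=> x; apply: le_trans (t0 0%N x) _; apply: ereal_sup_ubound; exists 0%N.
have mBA j : measurable (B j `\` A j : set L).
  by apply: measurableD => //; apply: borel_lebesgue_measurable; have [] := AB j.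
exists (\bigcup_j (B j `\` A j)); split.
- by apply: bigcup_measurable.
- apply/eqP; rewrite -measure_le0.
  apply: (@le_trans _ _ (\sum_(j <oo) nu (B j `\` A j))).
    by apply: measure_sigma_subadditive => //; exact: bigcup_measurable.
  by rewrite eseries0// => j _ _; have [] := AB j.
move=> x Gx nNx.
have BE j : B j x <-> A j x.
  split; last by have [_ + _] := AB j; apply.
  by move=> Bx; apply: contrapT => nA; apply: nNx; exists j.
apply/eqP; rewrite eq_le; apply/andP; split.
  apply: ge_ereal_sup => _ [j _ <-]; rewrite /t indicE; case: (boolP (x \in B j)) => [|_].
    by rewrite inE mulr1 => /BE[_ /ltW].
  by rewrite mulr0; exact: abse_ge0.
rewrite leNgt; apply/negP => uf.
have u0 : 0 <= u x by apply: le_trans (t0 0%N x) _; apply: ereal_sup_ubound; exists 0%N.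
have ufin : u x \is a fin_num.
  by rewrite ge0_fin_numE// (lt_le_trans uf)// leey.
have [b ub bf] : exists2 b : R, (fine (u x) < b)%R & b%:E <= `|f x|.
  move: uf; rewrite -(fineK ufin); case: `|f x| => [b| |]//.
    by rewrite lte_fin => ub; exists b.
  by move=> _; exists (fine (u x) + 1)%R; rewrite ?ltrDl// leey.
have [j /andP[uj jb]] := radius_seq_dense (fine_ge0 u0) ub.
have : t j x <= u x by apply: ereal_sup_ubound; exists j.
rewrite /t indicE mem_set ?mulr1; last first.
  by apply/BE; split => //=; apply: lt_le_trans bf; rewrite lte_fin.
by rewrite -(fineK ufin) lee_fin leNgt uj.
Qed.

End lebesgue_and_borel.

(** * The local maximal operator on fractional Sobolev spaces *)

Section extended_real_estimates.
Context {R : realType}.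
Local Open Scope ereal_scope.

Lemma abse_sub_le (a b k h1 h2 : \bar R) : a \is a fin_num -> b \is a fin_num ->
  0 <= k -> 0 <= h1 -> 0 <= h2 -> a <= b + k * h1 -> b <= a + k * h2 ->
  `|a - b| <= k * (h1 + h2).
Proof.
move=> afin bfin k0 h10 h20 ab ba; rewrite ge0_muleDr//.
have [ba'|/ltW ab'] := leP b a.
  rewrite gee0_abs ?sube_ge0 ?afin ?orbT//.
  by apply: (@le_trans _ _ (k * h1)); rewrite ?leeBlDl// leeDl// mule_ge0.
have -> : `|a - b| = `|b - a|.
  by rewrite -(fineK afin) -(fineK bfin) -!EFinB /= distrC.
rewrite gee0_abs ?sube_ge0 ?bfin ?orbT//.
by apply: (@le_trans _ _ (k * h2)); rewrite ?leeBlDl// leeDr// mule_ge0.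
Qed.

Lemma poweR_div_le (D h : \bar R) (p c d : R) : (0 <= p)%R -> (0 <= c)%R -> (0 <= d)%R ->
  (0 < d `^ p)%R -> 0 <= h -> D <= (c * d)%:E * h -> 0 <= D ->
  D `^ p / (d `^ p)%:E <= (c `^ p)%:E * h `^ p.
Proof.
move=> p0 c0 d0 dp0 h0 Dh D0.
have cd0 : 0 <= (c * d)%:E by rewrite lee_fin mulr_ge0.
rewrite inver gt_eqF// muleC -(@lee_pmul2l _ (d `^ p)%:E) ?lte_fin//.
rewrite muleA -EFinM divff ?gt_eqF// mul1e.
apply: (@le_trans _ _ (((c * d)%:E * h) `^ p)).
  by apply: gt0_ler_poweR; rewrite ?in_itv/= ?leey ?andbT ?D0 ?mule_ge0.
by rewrite poweRM// poweR_EFin powRM// EFinM [(c `^ p)%:E * (d `^ p)%:E]muleC muleA.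
Qed.

End extended_real_estimates.

Section maximal_function_in_sobolev.
Context {R : realType} {n : nat}.
Local Notation Rm := (measurableTypeR R).
Local Notation X := 'rV[Rm]_n.
Local Notation V := 'rV[R]_n.
Local Notation L := (lebesgue_space R n).
Local Notation mu := (@borel_lebesgue R n).
Local Notation nu := (lebesgue_rV R n).
Variables (s p : R).
Hypothesis s0 : 0 < s.
Hypothesis p1 : 1 < p.
Local Open Scope ereal_scope.

Let p0 : (0 < p)%R. Proof. exact: lt_trans p1. Qed.
Let p_neq0 : p != 0%R. Proof. by rewrite gt_eqF. Qed.

(** The order of the difference quotient whose [p]-th power is the Gagliardo
    integrand. *)
Let al : R := (n%:R / p + s)%R.
Let al0 : (0 < al)%R. Proof. by rewrite ltr_wpDl// divr_ge0// ltW. Qed.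

Let powR_al (d : R) : ((d `^ al) `^ p = d `^ (n%:R + s * p))%R.
Proof. by rewrite -powRrM /al mulrDl divfK. Qed.

Let gagliardo_ge0 (f : V -> \bar R) x y :
  0 <= `|f x - f y| `^ p / (enorm (x - y)%R `^ (n%:R + s * p))%:E.
Proof. by rewrite mule_ge0 ?poweR_ge0// inve_ge0 lee_fin powR_ge0. Qed.

Let Lp_normX G (f : V -> \bar R) : Lp_norm G p f `^ p = \int[nu]_(x in G) `|f x| `^ p.
Proof.
rewrite /Lp_norm poweR_Lnorm// [RHS]integral_mkcond; apply: eq_integral => x _.
by rewrite !patchE; case: ifPn => _ //; rewrite abse0 poweR0r.
Qed.

Section fixed_domain.
Variable G : set V.
Hypothesis oG : open G.
Hypothesis G_neq0 : G !=set0.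
Hypothesis G_neqT : G `<` setT.

Let mG : measurable (G : set X). Proof. exact: open_measurable_rV. Qed.
Let delta x := dist_to x (boundary G).
Let delta_gt0 x : G x -> (0 < delta x)%R.
Proof. exact: dist_to_boundary_gt0. Qed.
Let delta_lip x y : (delta x <= delta y + enorm (x - y))%R.
Proof. exact: dist_to_boundary_lip. Qed.
Let eball_delta x : G x -> eball x (delta x) `<=` G.
Proof. exact: eball_dist_to_boundary. Qed.

(** Values outside [G] are set to 0, so that integrals of [g] may be taken over
    the whole space. *)
Definition represents (f : V -> \bar R) (g : V -> R) :=
  [/\ forall x, (0 <= g x)%R, measurable_fun [set: X] g, forall x, ~ G x -> g x = 0%R &
   exists N : set L, [/\ measurable N, nu N = 0 & forall x, G x -> ~ N x -> `|f x| = (g x)%:E]].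

Lemma Lp_represents f : in_Lp G p f -> exists g, represents f g.
Proof.
move=> [mf foo]; have [u [mu' u0 [N [mN N0 uN]]]] := borel_representative mG mf.
pose v := u \_ G.
have mv : measurable_fun [set: X] v.
  by apply/(measurable_restrictT _ _).1 => //; exact: measurable_funTS.
have v0 x : 0 <= v x by exact: erestrict_ge0.
have mvp : measurable_fun [set: X] (fun x => v x `^ p) by exact: measurable_poweR_comp.
have vp0 x : 0 <= v x `^ p by exact: poweR_ge0.
have voo : \int[nu]_x (v x `^ p) < +oo.
  apply: (@le_lt_trans _ _ (\int[nu]_(x in G) `|f x| `^ p)).
    apply: (ge0_lower_integral_ge_ae mN N0).
    - exact: (borel_lebesgue_measurable_fun measurableT mvp).
    - exact: vp0.
    - by move=> x _; exact: poweR_ge0.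
    - by move=> x nGx; rewrite /v patchE memNset// poweR0r.
    - by move=> x Gx Nx; rewrite /v patchE mem_set// uN.
  by rewrite -Lp_normX poweR_lty.
rewrite integral_lebesgue_borel// in voo.
(* The representative is finite almost everywhere because its [p]-th power is
   integrable; elsewhere [fine] makes it finite. *)
have oo0 := ge0_integral_lty_infinity_null mvp vp0 voo.
pose Noo : set X := [set x | v x `^ p = +oo].
have mNoo : measurable (Noo : set X).
  rewrite (_ : Noo = setT `&` (fun x => v x `^ p) @^-1` [set +oo]); last by rewrite setTI.
  by apply: mvp => //; exact: emeasurable_set1.
exists (fun x => fine (v x)); split.
- by move=> x; exact: fine_ge0.
- exact: (measurableT_comp (fine_measurable measurableT) mv).
- by move=> x nGx; rewrite /v patchE memNset.
exists (N `|` (Noo : set L)); split.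
- by apply: measurableU => //; exact: borel_lebesgue_measurable.
- apply/eqP; rewrite -measure_le0.
  have mNL : measurable (Noo : set L) by exact: borel_lebesgue_measurable.
  apply: (@le_trans _ _ (nu N + nu Noo)); first exact: measureU2.
  by rewrite N0 add0e (lebesgue_rV_borel mNoo) oo0.
move=> x Gx /not_orP[Nx Noox].
have vx : v x = `|f x| by rewrite /v patchE mem_set// uN.
rewrite fineK ?vx// ge0_fin_numE// ltey; apply/eqP => foox; apply: Noox.
by rewrite /Noo/= vx foox poweRyr.
Qed.

Section representative.
Variables (f : V -> \bar R) (g : V -> R).
Hypothesis mf : measurable_fun (G : set L) (f : L -> \bar R).
Hypothesis fg : represents f g.

Let g0 : forall x, (0 <= g x)%R. Proof. by have [] := fg. Qed.
Let mg : measurable_fun [set: X] g. Proof. by have [] := fg. Qed.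
Let g_out : forall x, ~ G x -> g x = 0%R. Proof. by have [] := fg. Qed.

Let mg' : measurable_fun [set: X] (fun z => (g z)%:E).
Proof. exact/measurable_EFinP. Qed.
Let g0' z : 0 <= (g z)%:E. Proof. by rewrite lee_fin. Qed.

(** The balls of the supremum lie in [G], where [g] represents [|f|]. *)
Lemma local_maximal_represents x : G x -> local_maximal G f x = ball_max delta g x.
Proof.
move=> Gx; have [_ _ _ [N [mN N0 fN]]] := fg.
congr ereal_sup; apply/seteqP.
suff E r : (0 < r)%R -> (r < delta x)%R ->
    (nu (eball x r))^-1 * \int[nu]_(y in eball x r) `|f y| =
    ball_avg r (fun z => (g (x + z)%R)%:E).
  split => y [r r_itv <-]; exists r => //; move: r_itv; rewrite /= in_itv/= => /andP[? ?].
    by rewrite E.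
  by rewrite E.
move=> r0 rx.
have mB : measurable (eball x r : set X) by exact: measurable_eball.
have mBL : measurable (eball x r : set L) by exact: borel_lebesgue_measurable.
have BG : eball x r `<=` G.
  by move=> y yr; apply: (eball_delta Gx); rewrite /eball/= (lt_trans yr).
have -> : nu (eball x r) = (r ^+ n * ball_volume R n)%:E.
  by rewrite (lebesgue_rV_borel mB) -(measure_eball x r0).
rewrite inver gt_eqF; last by rewrite mulr_gt0 ?exprn_gt0 ?ball_volume_gt0.
rewrite /ball_avg -(ge0_integral_eball x r mg' g0'); congr (_ * _).
transitivity (\int[nu]_(y in eball x r) (g y)%:E).
  apply: ae_eq_integral.
  - exact: mBL.
  - have mfB := measurable_funS (borel_lebesgue_measurable mG) BG mf.
    apply: measurableT_comp; [exact: abse_measurable|exact: mfB].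
  - exact: (borel_lebesgue_measurable_fun mB (measurable_funTS mg')).
  exists N; split => // y /= ny; apply: contrapT => Ny; apply: ny => /BG Gy.
  exact: fN.
rewrite integral_mkcond [RHS]integral_mkcond integral_lebesgue_borel//.
  by apply/(measurable_restrictT _ _).1 => //; exact: measurable_funTS.
by move=> y; apply: erestrict_ge0.
Qed.

Lemma integral_represents_le : \int[mu]_x ((g x)%:E `^ p) <= Lp_norm G p f `^ p.
Proof.
have [_ _ _ [N [mN N0 fN]]] := fg.
have mgp : measurable_fun [set: X] (fun x => (g x)%:E `^ p) by exact: measurable_poweR_comp.
rewrite Lp_normX -integral_lebesgue_borel//; last by move=> x; exact: poweR_ge0.
apply: (ge0_lower_integral_ge_ae mN N0).
- exact: (borel_lebesgue_measurable_fun measurableT mgp).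
- by move=> x; exact: poweR_ge0.
- by move=> x _; exact: poweR_ge0.
- by move=> x /g_out ->; rewrite poweR_EFin powR0.
- by move=> x Gx Nx; rewrite fN.
Qed.

Let F := quotient G g al.

(** Passing to moduli decreases the increments of [f]. *)
Lemma energy_quotient_le : energy p F <= gagliardo_energy G s p f.
Proof.
have [_ _ _ [N [mN N0 fN]]] := fg.
have mF : measurable_fun [set: X * X] F by exact: measurable_quotient.
have mFp : measurable_fun [set: X * X] (fun w => F w `^ p) by exact: measurable_poweR_comp.
have Fp0 w : 0 <= F w `^ p by exact: poweR_ge0.
have mI : measurable_fun [set: X] (fun x => \int[mu]_y (F (x, y) `^ p)).
  exact: (measurable_integral_snd mFp Fp0).
have F_out x y : ~ (G x /\ G y) -> F (x, y) = 0.
  by move=> nG; rewrite /F /quotient indicE memNset// !mul0r.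
have le_pointwise x y : G x -> ~ N x -> G y -> ~ N y ->
    F (x, y) `^ p <= `|f x - f y| `^ p / (enorm (x - y)%R `^ (n%:R + s * p))%:E.
  move=> Gx Nx Gy Ny.
  have [->|xy] := eqVneq x y.
    have -> : F (y, y) = 0 by rewrite /F /quotient/= subrr normr0 mulr0 mul0r.
    by rewrite poweR0r//; exact: gagliardo_ge0.
  have d0 : (0 < enorm (x - y))%R by exact: enorm_gt0.
  have := fN x Gx Nx; have := fN y Gy Ny.
  case: (f x) => [a| |]//; case: (f y) => [b| |]// [gb] [ga].
  have -> : F (x, y) = (`| `|a| - `|b| | / enorm (x - y) `^ al)%:E.
    by rewrite /F /quotient/= indicE mem_set//= mul1r ga gb.
  have -> : `|a%:E - b%:E| = `|a - b|%:E by [].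
  rewrite !poweR_EFin inver gt_eqF ?powR_gt0// -EFinM lee_fin.
  rewrite powRM ?invr_ge0 ?powR_ge0// -powRN -[((_ `^ - al) `^ p)%R]powRrM mulNr powRN powRrM powR_al.
  rewrite ler_wpM2r ?invr_ge0 ?powR_ge0//.
  by apply: ge0_ler_powR; rewrite ?nnegrE ?(ltW p0)// ler_dist_dist.
rewrite /energy -integral_lebesgue_borel//; last by move=> x; exact: integral_ge0.
apply: (ge0_lower_integral_ge_ae mN N0).
- exact: (borel_lebesgue_measurable_fun measurableT mI).
- by move=> x; exact: integral_ge0.
- by move=> x _; apply: integral_ge0 => y _; exact: gagliardo_ge0.
- by move=> x nGx; apply: integral0_eq => y _; rewrite F_out ?poweR0r// => -[].
move=> x Gx Nx.
have mFx : measurable_fun [set: X] (fun y => F (x, y) `^ p).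
  by apply: (measurableT_comp mFp); exact: measurable_pair1.
rewrite -integral_lebesgue_borel//.
apply: (ge0_lower_integral_ge_ae mN N0).
- exact: (borel_lebesgue_measurable_fun measurableT mFx).
- by move=> y; exact: Fp0.
- by move=> y _; exact: gagliardo_ge0.
- by move=> y nGy; rewrite F_out ?poweR0r// => -[].
- by move=> y Gy Ny; exact: le_pointwise.
Qed.

Let M := ball_max delta g.

Let M0 x : G x -> 0 <= M x. Proof. by move=> Gx; exact: (ball_max_ge0 delta_gt0 g0 Gx). Qed.

Let mM : measurable_fun (G : set X) M.
Proof. exact: (measurable_ball_max delta_lip mG g0 mg). Qed.

Lemma measurable_local_maximal : measurable_fun (G : set L) (local_maximal G f).
Proof.
have := borel_lebesgue_measurable_fun mG mM.
apply: eq_measurable_fun => x; rewrite inE => Gx.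
by rewrite local_maximal_represents.
Qed.

Let MG := M \_ G.

Let mMG : measurable_fun [set: X] MG.
Proof. exact/(measurable_restrictT _ _).1. Qed.

Let MG0 x : 0 <= MG x.
Proof. by rewrite /MG patchE; case: ifPn => //; rewrite inE => /M0. Qed.

Lemma integral_ball_max_le (C : R) : (0 < C)%R ->
  (forall u : V -> \bar R, measurable_fun [set: X] u -> (forall x, 0 <= u x) ->
    \int[mu]_x (max_fun u x `^ p) <= C%:E * \int[mu]_x (u x `^ p)) ->
  \int[mu]_x (MG x `^ p) <=
    ((4 ^+ n / ball_volume R n) `^ p * C)%:E * \int[mu]_x ((g x)%:E `^ p).
Proof.
move=> C0 strong; set k := (4 ^+ n / ball_volume R n)%R.
have k0 : (0 <= k)%R by rewrite divr_ge0 ?exprn_ge0// ltW// ball_volume_gt0.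
have mMf := measurable_max_fun mg' g0'.
have Mf0 x : 0 <= max_fun (fun z => (g z)%:E) x by exact: max_avg_ge0.
have mMfp := measurable_poweR_comp p mMf.
rewrite EFinM -muleA.
apply: (@le_trans _ _ ((k `^ p)%:E * \int[mu]_x (max_fun (fun z => (g z)%:E) x `^ p))).
  2: by apply: lee_wpmul2l; [rewrite lee_fin powR_ge0|exact: strong].
rewrite -ge0_integralZl//; last 2 first.
- by move=> x _; exact: poweR_ge0.
- by rewrite lee_fin powR_ge0.
apply: ge0_le_integral => //.
- by move=> x _; exact: poweR_ge0.
- exact: measurable_poweR_comp.
- exact: measurable_funeM.
move=> x _; rewrite -poweR_EFin -poweRM ?lee_fin//.
apply: gt0_ler_poweR; rewrite ?(ltW p0) ?in_itv/= ?leey ?andbT ?mule_ge0 ?lee_fin//.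
rewrite /MG patchE; case: ifPn => _; last by rewrite mule_ge0 ?lee_fin.
exact: (ball_max_le_max_fun delta g0 mg x).
Qed.

Lemma Lp_norm_local_maximalX :
  Lp_norm G p (local_maximal G f) `^ p = \int[mu]_x (MG x `^ p).
Proof.
rewrite Lp_normX -integral_lebesgue_borel; last 2 first.
- exact: measurable_poweR_comp.
- by move=> x; exact: poweR_ge0.
rewrite integral_mkcond; apply: eq_integral => x _; rewrite /MG !patchE.
case: ifPn => [|_]; last by rewrite poweR0r.
by rewrite inE => Gx; rewrite local_maximal_represents// gee0_abs// M0.
Qed.

(** The energy of the maximal function is controlled through the pointwise
    estimate, symmetrized in the two points. *)
Lemma energy_local_maximal_le (C : R) : (0 < C)%R ->
  energy p (quotient_max F) <= C%:E * energy p F ->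
  \int[mu]_x (MG x `^ p) < +oo ->
  gagliardo_energy G s p (local_maximal G f) <=
    (@pointwise_cst R n al `^ p * (2 `^ p * (C + C)))%:E * energy p F.
Proof.
move=> C0 HC Moo.
have mF : measurable_fun [set: X * X] F by exact: measurable_quotient.
have F0 w : 0 <= F w by exact: quotient_ge0.
have leF a b D : G a -> G b -> (enorm (a - b) <= D)%R ->
    (g a)%:E <= (g b)%:E + (D `^ al)%:E * F (a, b) by exact: le_quotient.
(* [H] is made opaque, so that unification never unfolds the maximal functions. *)
have [H HE] : exists H, H = quotient_max F by exists (quotient_max F).
pose H' := swap_args H; rewrite -HE in HC.
have mH : measurable_fun [set: X * X] H by rewrite HE; exact: measurable_quotient_max.
have mH' : measurable_fun [set: X * X] H' by exact: measurable_swap_args.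
have H0 w : 0 <= H w by rewrite HE; exact: quotient_max_ge0.
have H0' w : 0 <= H' w by exact: H0.
pose c : R := @pointwise_cst R n al.
have c0 : (0 <= c)%R.
  rewrite /c /pointwise_cst !mulr_ge0 ?powR_ge0 ?invr_ge0 ?exprn_ge0//.
    by rewrite ltW// ball_volume_gt0.
  by rewrite ltW// ball_volume_gt0.
pose K w := (c `^ p)%:E * (H w + H' w) `^ p.
have mHH := measurable_poweR_comp p (emeasurable_funD mH mH').
have mK : measurable_fun [set: X * X] K by exact: measurable_funeM.
have K0 w : 0 <= K w by rewrite mule_ge0 ?poweR_ge0 ?lee_fin ?powR_ge0.
(* Outside the null set [N] the differences of values of the maximal function are
   not of the form [+oo - +oo]. *)
pose N : set X := [set x | MG x `^ p = +oo].
have mN : measurable (N : set X).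
  rewrite (_ : N = setT `&` (fun x => MG x `^ p) @^-1` [set +oo]); last by rewrite setTI.
  by apply: (measurable_poweR_comp p mMG) => //; exact: emeasurable_set1.
have mNL : measurable (N : set L) by exact: borel_lebesgue_measurable.
have N0 : nu N = 0.
  rewrite (lebesgue_rV_borel mN); apply: ge0_integral_lty_infinity_null => //.
    exact: measurable_poweR_comp.
  by move=> x; exact: poweR_ge0.
have Mfin x : G x -> ~ N x -> M x \is a fin_num.
  move=> Gx Nx; rewrite ge0_fin_numE ?M0// ltey; apply/eqP => Mx; apply: Nx.
  by rewrite /N/= /MG patchE mem_set// Mx poweRyr.
have le_pointwise x y : G x -> ~ N x -> G y -> ~ N y ->
    `|M x - M y| `^ p / (enorm (x - y)%R `^ (n%:R + s * p))%:E <= K (x, y).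
  move=> Gx Nx Gy Ny; rewrite -powR_al.
  have Mx := fineK (Mfin x Gx Nx); have My := fineK (Mfin y Gy Ny).
  have [->|xy] := eqVneq x y.
    by rewrite -My -EFinB subrr abse0 poweR0r// mul0e K0.
  have d0 : (0 < enorm (x - y))%R by exact: enorm_gt0.
  set d := enorm (x - y) in d0 *.
  have yx : y != x by rewrite eq_sym.
  have xyle : M x <= M y + (c * d `^ al)%:E * H (x, y).
    rewrite HE; exact: (ball_max_le delta_gt0 delta_lip eball_delta g0 mg al0 mF F0 leF Gx Gy xy).
  have yxle : M y <= M x + (c * d `^ al)%:E * H' (x, y).
    rewrite /H' /swap_args HE /d enormB.
    exact: (ball_max_le delta_gt0 delta_lip eball_delta g0 mg al0 mF F0 leF Gy Gx yx).
  have cd0 : 0 <= (c * d `^ al)%:E by rewrite lee_fin mulr_ge0// powR_ge0.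
  have Mxy : `|M x - M y| <= (c * d `^ al)%:E * (H (x, y) + H' (x, y)).
    exact: (abse_sub_le (Mfin x Gx Nx) (Mfin y Gy Ny) cd0 (H0 _) (H0' _) xyle yxle).
  apply: (poweR_div_le (ltW p0) c0 _ _ (adde_ge0 (H0 _) (H0' _)) Mxy (abse_ge0 _)).
    exact: powR_ge0.
  by rewrite powR_al powR_gt0.
have EK : \int[mu]_x \int[mu]_y K (x, y) =
    (c `^ p)%:E * energy p (fun w => H w + H' w).
  apply: (integral2Z (powR_ge0 _ _) mHH) => w; exact: poweR_ge0.
apply: (@le_trans _ _ (\int[mu]_x \int[mu]_y K (x, y))); last first.
  rewrite EK EFinM -muleA; apply: lee_wpmul2l; first by rewrite lee_fin powR_ge0.
  apply: (le_trans (energyD_le (ltW p0) mH mH' H0 H0')).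
  rewrite EFinM -muleA; apply: lee_wpmul2l; first by rewrite lee_fin powR_ge0.
  have EH' : energy p H' = energy p H.
    apply/esym; apply: (integral2_swap (measurable_poweR_comp p mH)) => w.
    exact: poweR_ge0.
  have HC' : energy p H' <= C%:E * energy p F by rewrite EH'.
  apply: (le_trans (leeD HC HC')); move: (energy p F) => e.
  by rewrite EFinD ge0_muleDl ?lee_fin ?(ltW C0).
have mI := measurable_integral_snd mK K0.
have I0 x : 0 <= \int[mu]_y K (x, y) by exact: integral_ge0.
rewrite -(integral_lebesgue_borel mI I0).
apply: (ge0_le_lower_integral_ae mNL N0).
- exact: (borel_lebesgue_measurable_fun measurableT mI).
- exact: I0.
- by move=> x _; apply: integral_ge0 => y _; exact: gagliardo_ge0.
move=> x Gx Nx.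
have mKx : measurable_fun [set: X] (fun y => K (x, y)).
  by apply: (measurableT_comp mK); exact: measurable_pair1.
rewrite -(integral_lebesgue_borel mKx (fun y => K0 _)).
apply: (ge0_le_lower_integral_ae mNL N0).
- exact: (borel_lebesgue_measurable_fun measurableT mKx).
- by move=> y; exact: K0.
- by move=> y _; exact: gagliardo_ge0.
move=> y Gy Ny; rewrite !local_maximal_represents//; exact: le_pointwise.
Qed.

End representative.
End fixed_domain.

Lemma Lp_norm_local_maximal_le : exists2 K : R, (0 < K)%R &
  forall G : set V, open G -> G !=set0 -> G `<` setT ->
  forall f : V -> \bar R, in_Lp G p f ->
    Lp_norm G p (local_maximal G f) <= K%:E * Lp_norm G p f.
Proof.
have [C C0 strong] := @max_fun_strong_type R n p p1.
pose k : R := (4 ^+ n / ball_volume R n)%R.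
have k0 : (0 < k)%R by rewrite divr_gt0 ?exprn_gt0 ?ball_volume_gt0.
have kC0 : (0 < k `^ p * C)%R by rewrite mulr_gt0// powR_gt0.
exists ((k `^ p * C) `^ p^-1)%R; first exact: powR_gt0.
move=> G oG G_neq0 G_neqT f fLp; have [g fg] := Lp_represents oG fLp.
have N0 (h : V -> \bar R) : 0 <= Lp_norm G p h by exact: Lnorm_ge0.
have rootX (a : \bar R) : 0 <= a -> (a `^ p) `^ p^-1 = a.
  by move=> a0; rewrite -poweRrM divff// poweRe1.
have := integral_ball_max_le oG G_neq0 G_neqT fg C0 strong.
rewrite -(Lp_norm_local_maximalX oG G_neq0 G_neqT fLp.1 fg) => le1.
have le2 := integral_represents_le fg.
rewrite -[leLHS]rootX// -[Y in _ * Y]rootX// -poweR_EFin -poweRM ?poweR_ge0 ?lee_fin ?(ltW kC0)//.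
apply: gt0_ler_poweR; rewrite ?invr_ge0 ?(ltW p0)// ?in_itv/= ?leey ?andbT ?poweR_ge0//.
  by rewrite mule_ge0 ?poweR_ge0 ?lee_fin ?(ltW kC0).
by apply: (le_trans le1); apply: lee_wpmul2l; rewrite // lee_fin ltW.
Qed.

Lemma measurable_local_maximal_Lp (G : set V) (f : V -> \bar R) :
  open G -> G !=set0 -> G `<` setT -> in_Lp G p f ->
  measurable_fun (G : set L) (local_maximal G f).
Proof.
move=> oG G_neq0 G_neqT fLp; have [g fg] := Lp_represents oG fLp.
exact: (measurable_local_maximal oG G_neq0 G_neqT fLp.1 fg).
Qed.

Lemma gagliardo_energy_local_maximal_le : exists2 C : R, (0 < C)%R &
  forall G : set V, open G -> G !=set0 -> G `<` setT ->
  forall f : V -> \bar R, in_Lp G p f ->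
    gagliardo_energy G s p (local_maximal G f) <= C%:E * gagliardo_energy G s p f.
Proof.
have [K K0 LpK] := Lp_norm_local_maximal_le.
have [C C0 HC] := @quotient_max_bound R n p p1.
pose c : R := @pointwise_cst R n al.
have c0 : (0 < c)%R.
  rewrite /c /pointwise_cst !mulr_gt0 ?powR_gt0 ?invr_gt0 ?exprn_gt0//.
    exact: ball_volume_gt0.
  exact: ball_volume_gt0.
have cC0 : (0 < c `^ p * (2 `^ p * (C + C)))%R.
  by rewrite !mulr_gt0 ?powR_gt0 ?addr_gt0.
exists (c `^ p * (2 `^ p * (C + C)))%R => //.
move=> G oG G_neq0 G_neqT f fLp; have [g fg] := Lp_represents oG fLp.
have [g0 mg _ _] := fg.
have mG : measurable (G : set X) by exact: open_measurable_rV.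
have mQ : measurable_fun [set: X * X] (quotient G g al) by exact: measurable_quotient.
have HCF := HC _ mQ (quotient_ge0 G g al).
have Moo : Lp_norm G p (local_maximal G f) `^ p < +oo.
  apply: poweR_lty; apply: (le_lt_trans (LpK G oG G_neq0 G_neqT f fLp)).
  have [_ foo] := fLp; have f0 : 0 <= Lp_norm G p f by exact: Lnorm_ge0.
  by rewrite lte_mul_pinfty// lee_fin ltW.
rewrite (Lp_norm_local_maximalX oG G_neq0 G_neqT fLp.1 fg) in Moo.
apply: (le_trans (energy_local_maximal_le oG G_neq0 G_neqT fLp.1 fg C0 HCF Moo)).
apply: lee_wpmul2l; first by rewrite lee_fin ltW.
exact: (energy_quotient_le oG fg).
Qed.

End maximal_function_in_sobolev.

Theorem theorem1p1 (R : realType) (n : nat) (s p : R)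
    (hs0 : 0 < s) (hs1 : s < 1) (hp : 1 < p) :
  exists2 C : R, 0 < C & forall G : set 'rV[R]_n,
    open G -> G !=set0 -> G `<` [set: 'rV[R]_n] ->
    (forall f : 'rV[R]_n -> \bar R, in_Lp G p f ->
      (gagliardo_energy G s p (local_maximal G f)
        <= C%:E * gagliardo_energy G s p f)%E) /\
    (exists2 C' : R, 0 < C' & forall f : 'rV[R]_n -> \bar R,
      in_sobolev G s p f ->
      in_sobolev G s p (local_maximal G f) /\
      (sobolev_norm G s p (local_maximal G f)
        <= C'%:E * sobolev_norm G s p f)%E).
Proof.
have [C C0 HC] := @gagliardo_energy_local_maximal_le R n s p hs0 hp.
have [K K0 HK] := @Lp_norm_local_maximal_le R n p hp.
exists C => // G oG G_neq0 G_neqT; split; first by move=> f; exact: HC.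
have p0 : 0 < p by exact: lt_trans hp.
pose C' := C `^ p^-1.
have C'0 : 0 < C' by exact: powR_gt0.
exists (K + C'); first exact: addr_gt0.
move=> f [fLp foo]; have [mf Lpoo] := fLp.
have N0 (h : 'rV[R]_n -> \bar R) : (0 <= Lp_norm G p h)%E by exact: Lnorm_ge0.
have E0 (h : 'rV[R]_n -> \bar R) : (0 <= gagliardo_energy G s p h)%E.
  apply: integral_ge0 => x _; apply: integral_ge0 => y _.
  by rewrite mule_ge0 ?poweR_ge0// inve_ge0 lee_fin powR_ge0.
have S0 (h : 'rV[R]_n -> \bar R) : (0 <= gagliardo_seminorm G s p h)%E by exact: poweR_ge0.
have leN : (Lp_norm G p (local_maximal G f) <= K%:E * Lp_norm G p f)%E by exact: HK.
have leS : (gagliardo_seminorm G s p (local_maximal G f)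
    <= C'%:E * gagliardo_seminorm G s p f)%E.
  rewrite /gagliardo_seminorm -poweR_EFin -poweRM ?lee_fin ?(ltW C0)//.
  apply: gt0_ler_poweR; rewrite ?invr_ge0 ?(ltW p0)// ?in_itv/= ?leey ?andbT ?E0//.
    by rewrite mule_ge0 ?lee_fin ?(ltW C0).
  exact: HC.
have le_norm : (sobolev_norm G s p (local_maximal G f)
    <= (K + C')%:E * sobolev_norm G s p f)%E.
  have Ke0 : (0 <= K%:E)%E by rewrite lee_fin ltW.
  have Ce0 : (0 <= C'%:E)%E by rewrite lee_fin ltW.
  rewrite /sobolev_norm ge0_muleDr//; apply: leeD.
    by apply: (le_trans leN); apply: lee_wpmul2r; rewrite // lee_fin lerDl ltW.
  by apply: (le_trans leS); apply: lee_wpmul2r; rewrite // lee_fin lerDr ltW.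
split; last exact: le_norm.
split; last first.
  apply: (le_lt_trans le_norm); rewrite lte_mul_pinfty//.
  - by rewrite lee_fin addr_ge0// ltW.
split; first exact: (measurable_local_maximal_Lp hp oG G_neq0 G_neqT fLp).
by apply: (le_lt_trans leN); rewrite lte_mul_pinfty// lee_fin ltW.
Qed.
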